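(* (1) $W^*_\kappa[K_3+e]=W[K_3+e]=3$, where $K_3+e$ is the paw graph (a triangle plus a vertex adjacent to exactly one triangle vertex). (2) $W^*_\kappa[P_4]=W^*[P_4]=3$ and $W_\kappa[P_4]=W[P_4]=4$, where $P_4$ is the path on 4 vertices. (3) For each $F\in\{K_4,\ C_4,\ K_{1,3},\ K_4\setminus e\}$ (the remaining connected graphs on 4 vertices), $W^*_\kappa[F]=W[F]=4$.
   Context: Graphs are finite, simple, undirected, loopless; $K_{1,3}$ is the claw, $K_4\setminus e$ the diamond, $C_4$ the 4-cycle. First-order sentences about graphs use only adjacency $\sim$ and equality $=$. Write $F\sqsubset G$ if $G$ contains an induced copy of $F$. $W[F]$ is the minimum number of distinct variables in a first-order sentence $\Phi$ with $G\models\Phi$ iff $F\sqsubset G$ for all graphs $G$. $W_\kappa[F]$ is the minimum $k$ for which there are a first-order sentence $\Phi$ with $k$ distinct variables and a number $s$ such that $G\models\Phi$ iff $F\sqsubset G$ for all $s$-connected graphs $G$. For non-isomorphic $G,H$, $W(G,H)$ is the minimum number of distinct variables in a sentence true on one and false on the other; $W^*[F]=\max\{W(G,H):F\sqsubset G,\ F\not\sqsubset H\}$ and $W^*_\kappa[F]=\min_s\max\{W(G,H): F\sqsubset G,\ F\not\sqsubset H,\ G,H\text{ both }s\text{-connected}\}$. *)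

(* Defs.v *)
From mathcomp Require Import all_boot.

Set Implicit Arguments.
Unset Strict Implicit.
Unset Printing Implicit Defensive.

(* As usual for first-order structures, the vertex set is non-empty. *)
Record graph := Graph {
  vertex :> finType;
  adj : rel vertex;
  adj_sym : symmetric adj;
  adj_irr : irreflexive adj;
  vertex_gt0 : 0 < #|vertex| }.

Definition induced_copy (F G : graph) : Prop :=
  exists2 f : vertex F -> vertex G,
    injective f & forall x y : vertex F, adj (f x) (f y) = adj x y.

Definition adj_off (G : graph) (S : {set vertex G}) : rel (vertex G) :=
  [rel x y | [&& x \notin S, y \notin S & adj x y]].

Definition s_connected (s : nat) (G : graph) : Prop :=
  s < #|vertex G| /\
  forall S : {set vertex G}, #|S| < s ->
    forall x y, x \notin S -> y \notin S -> connect (adj_off S) x y.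

Inductive formula : Type :=
  | FEq of nat & nat
  | FAdj of nat & nat
  | FNot of formula
  | FAnd of formula & formula
  | FOr of formula & formula
  | FImp of formula & formula
  | FEx of nat & formula
  | FAll of nat & formula.

Fixpoint vars (p : formula) : seq nat :=
  match p with
  | FEq i j | FAdj i j => [:: i; j]
  | FNot p => vars p
  | FAnd p q | FOr p q | FImp p q => vars p ++ vars q
  | FEx i p | FAll i p => i :: vars p
  end.

Fixpoint free_vars (p : formula) : seq nat :=
  match p with
  | FEq i j | FAdj i j => [:: i; j]
  | FNot p => free_vars p
  | FAnd p q | FOr p q | FImp p q => free_vars p ++ free_vars q
  | FEx i p | FAll i p => [seq j <- free_vars p | j != i]
  end.

Definition sentence (p : formula) : Prop := free_vars p = [::].

(* A variable quantified several times counts once. *)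
Definition nvars (p : formula) : nat := size (undup (vars p)).

Fixpoint sat (G : graph) (e : nat -> vertex G) (p : formula) : bool :=
  match p with
  | FEq i j => e i == e j
  | FAdj i j => adj (e i) (e j)
  | FNot p => ~~ sat e p
  | FAnd p q => sat e p && sat e q
  | FOr p q => sat e p || sat e q
  | FImp p q => sat e p ==> sat e q
  | FEx i p => [exists v : vertex G, sat [eta e with i |-> v] p]
  | FAll i p => [forall v : vertex G, sat [eta e with i |-> v] p]
  end.

Definition models (G : graph) (p : formula) : Prop :=
  forall e : nat -> vertex G, sat e p.

Definition is_min (P : nat -> Prop) (k : nat) : Prop :=
  P k /\ forall m, P m -> k <= m.

Definition is_max (P : nat -> Prop) (k : nat) : Prop :=
  P k /\ forall m, P m -> m <= k.

(* The width parameters are minima or maxima of sets of numbers, rendered as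
   relations: W_is F k means that W[F] exists and equals k, and so on. *)

Definition W_is (F : graph) : nat -> Prop :=
  is_min (fun k => exists p : formula,
    [/\ sentence p, nvars p = k &
        forall G : graph, models G p <-> induced_copy F G]).

Definition Wkappa_is (F : graph) : nat -> Prop :=
  is_min (fun k => exists (p : formula) (s : nat),
    [/\ sentence p, nvars p = k &
        forall G : graph, s_connected s G ->
          (models G p <-> induced_copy F G)]).

Definition distinguishes (p : formula) (G H : graph) : Prop :=
  (models G p /\ ~ models H p) \/ (models H p /\ ~ models G p).

(* W(G,H) = k; no such k exists when G and H are isomorphic. *)
Definition W_pair_is (G H : graph) : nat -> Prop :=
  is_min (fun k => exists p : formula,
    [/\ sentence p, nvars p = k & distinguishes p G H]).

Definition Wstar_is (F : graph) : nat -> Prop :=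
  is_max (fun k => exists G H : graph,
    [/\ induced_copy F G, ~ induced_copy F H & W_pair_is G H k]).

Definition Wstar_conn_is (F : graph) (s : nat) : nat -> Prop :=
  is_max (fun k => exists G H : graph,
    [/\ induced_copy F G, ~ induced_copy F H,
        s_connected s G, s_connected s H & W_pair_is G H k]).

Definition Wstarkappa_is (F : graph) : nat -> Prop :=
  is_min (fun k => exists s : nat, Wstar_conn_is F s k).

Section EdgeList.
Variable es : seq (nat * nat).

Definition edge_rel : rel 'I_4 :=
  [rel i j : 'I_4 | (i != j) &&
    (((val i, val j) \in es) || ((val j, val i) \in es))].

Lemma edge_rel_sym : symmetric edge_rel.
Proof. by move=> i j; rewrite /edge_rel /= eq_sym orbC. Qed.

Lemma edge_rel_irr : irreflexive edge_rel.
Proof. by move=> i; rewrite /edge_rel /= eqxx. Qed.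

Lemma ord4_gt0 : 0 < #|'I_4|.
Proof. by rewrite card_ord. Qed.

Definition graph4 : graph := Graph edge_rel_sym edge_rel_irr ord4_gt0.
End EdgeList.

Definition paw : graph := graph4 [:: (0, 1); (0, 2); (1, 2); (2, 3)].
Definition P4 : graph := graph4 [:: (0, 1); (1, 2); (2, 3)].
Definition K4 : graph :=
  graph4 [:: (0, 1); (0, 2); (0, 3); (1, 2); (1, 3); (2, 3)].
Definition C4 : graph := graph4 [:: (0, 1); (1, 2); (2, 3); (0, 3)].
Definition claw : graph := graph4 [:: (0, 1); (0, 2); (0, 3)].
Definition diamond : graph :=
  graph4 [:: (0, 1); (0, 2); (0, 3); (1, 2); (1, 3)].

(* Main.v *)
Require Import Defs.
From mathcomp Require Import all_boot.
From mathcomp Require Import zify.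

(** All lower bounds come from pebble games.  With two variables only single
    edges and non-edges can be probed, so the complement of a rook's graph and
    a complete bipartite graph are indistinguishable.  With three variables, two
    graphs agree as soon as the adjacency types over two vertices match:
    this holds for K(m,m,m,m) and K(m,m,m), for rook's graphs and their
    complements, and for a triangle-free circulant graph and the Petersen graph
    (to which universal vertices are added for connectivity).

    For P4, a pair of vertices survives an iterated refinement, expressible
    with three variables, when it lies in a common P4; in a P4-free graph every
    set of at least two vertices is cut by a disjoint union or a join
    (Seinsche), so that the refinement ends with singletons.  No bounded number
    of refinement rounds suffices: words over four letters, adjacent according
    to the parity of the first position where they differ, form a cograph, and
    replacing one middle level by a P4 stays undetected by short games. *)

Set Implicit Arguments.
Unset Strict Implicit.
Unset Printing Implicit Defensive.

(** * Pebble games and width parameters *)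

Lemma sat_free (G : graph) p (e e' : nat -> G) :
  {in free_vars p, e =1 e'} -> sat e p = sat e' p.
Proof.
elim: p e e' => [i j|i j|p IH|p IHp q IHq|p IHp q IHq|p IHp q IHq|i p IH|i p IH]
  e e' ee' /=.
- by rewrite !ee' ?inE ?eqxx ?orbT.
- by rewrite !ee' ?inE ?eqxx ?orbT.
- by rewrite (IH e e').
- by rewrite (IHp e e') 1?(IHq e e') // => t tp; apply: ee'; rewrite mem_cat tp ?orbT.
- by rewrite (IHp e e') 1?(IHq e e') // => t tp; apply: ee'; rewrite mem_cat tp ?orbT.
- by rewrite (IHp e e') 1?(IHq e e') // => t tp; apply: ee'; rewrite mem_cat tp ?orbT.
- apply: eq_existsb => v; apply: IH => t tp /=.
  by case: eqP => // /eqP ti; apply: ee'; rewrite mem_filter ti.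
- apply: eq_forallb => v; apply: IH => t tp /=.
  by case: eqP => // /eqP ti; apply: ee'; rewrite mem_filter ti.
Qed.

Lemma models_sat (G : graph) p (e : nat -> G) :
  sentence p -> models G p <-> sat e p.
Proof.
move=> sp; split=> [|h e']; first exact.
by rewrite (@sat_free _ _ e' e) // => t; rewrite sp.
Qed.

(** Quantifier rank: the number of rounds of the pebble game in which Spoiler can exploit [p]. *)
Fixpoint qrank (p : formula) : nat :=
  match p with
  | FEq _ _ | FAdj _ _ => 0
  | FNot p => qrank p
  | FAnd p q | FOr p q | FImp p q => maxn (qrank p) (qrank q)
  | FEx _ p | FAll _ p => (qrank p).+1
  end.

Section Game.
Variables (G H : graph) (V : seq nat).
Variable Inv : nat -> (nat -> G) -> (nat -> H) -> Prop.
Hypothesis inv_atom : forall k e e', Inv k e e' -> {in V &, forall i j,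
  (e i == e j) = (e' i == e' j) /\ adj (e i) (e j) = adj (e' i) (e' j)}.
Hypothesis forth : forall k e e', Inv k.+1 e e' -> forall i z, i \in V ->
  exists z', Inv k [eta e with i |-> z] [eta e' with i |-> z'].
Hypothesis back : forall k e e', Inv k.+1 e e' -> forall i z', i \in V ->
  exists z, Inv k [eta e with i |-> z] [eta e' with i |-> z'].

(** [Inv k] says that Duplicator survives [k] more rounds. Each nested quantifier of [p] spends one
    round, and the variables in [V] are the pebbles. *)
Lemma game_sat p k e e' :
  {subset vars p <= V} -> qrank p <= k -> Inv k e e' -> sat e p = sat e' p.
Proof.
elim: p k e e' => [i j|i j|p IH|p IHp q IHq|p IHp q IHq|p IHp q IHq|i p IH|i p IH]
  k e e' /= sV.
- by move=> _ /inv_atom h; case: (h i j) => //; apply: sV; rewrite !inE eqxx ?orbT.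
- by move=> _ /inv_atom h; case: (h i j) => //; apply: sV; rewrite !inE eqxx ?orbT.
- by move=> rk /(IH _ _ _ sV rk) ->.
- rewrite geq_max => /andP[rp rq] h; rewrite (IHp k e e') ?(IHq k e e') //
    => t tp; apply: sV; by rewrite mem_cat tp ?orbT.
- rewrite geq_max => /andP[rp rq] h; rewrite (IHp k e e') ?(IHq k e e') //
    => t tp; apply: sV; by rewrite mem_cat tp ?orbT.
- rewrite geq_max => /andP[rp rq] h; rewrite (IHp k e e') ?(IHq k e e') //
    => t tp; apply: sV; by rewrite mem_cat tp ?orbT.
- have iV : i \in V by apply: sV; rewrite inE eqxx.
  have sV' : {subset vars p <= V} by move=> t tp; apply: sV; rewrite inE tp orbT.
  case: k => // k rk h; apply/existsP/existsP => -[z hz].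
    by have [z' h'] := forth h z iV; exists z'; rewrite -(IH _ _ _ sV' rk h').
  by have [z' h'] := back h z iV; exists z'; rewrite (IH _ _ _ sV' rk h').
- have iV : i \in V by apply: sV; rewrite inE eqxx.
  have sV' : {subset vars p <= V} by move=> t tp; apply: sV; rewrite inE tp orbT.
  case: k => // k rk h; apply/forallP/forallP => hz z.
    by have [z' h'] := back h z iV; rewrite -(IH _ _ _ sV' rk h').
  by have [z' h'] := forth h z iV; rewrite (IH _ _ _ sV' rk h').
Qed.
End Game.

Lemma others2 (V : seq nat) i : uniq V -> size V <= 2 -> i \in V ->
  exists2 j, j \in V & {in V, forall t, t = i \/ t = j}.
Proof.
case: V => [|a [|b []]] //= _ _; rewrite !inE.
  by move/eqP->; exists a; [rewrite inE | move=> t; rewrite inE => /eqP->; left].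
case/orP=> /eqP->; [exists b|exists a]; rewrite ?inE ?eqxx ?orbT // => t;
  by rewrite !inE => /orP[] /eqP->; auto.
Qed.

(** Spoiler moves pebble [i]; the others are [j] and [l], with repetitions when [V] has fewer than
    three members. *)
Lemma others3 (V : seq nat) i : uniq V -> size V <= 3 -> i \in V ->
  exists j l, [/\ j \in V, l \in V & {in V, forall t, [\/ t = i, t = j | t = l]}].
Proof.
case: V => [|a [|b [|c []]]] //= _ _; rewrite !inE.
- move/eqP->; exists a, a; split; rewrite ?inE ?eqxx // => t.
  by rewrite inE => /eqP->; constructor.
- case/orP=> /eqP->; [exists b, b|exists a, a]; split; rewrite ?inE ?eqxx ?orbT // => t;
  by rewrite !inE => /orP[] /eqP->; by [constructor 1|constructor 2].
- case/or3P=> /eqP->; [exists b, c|exists a, c|exists a, b];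
  split; rewrite ?inE ?eqxx ?orbT // => t;
  by rewrite !inE => /or3P[] /eqP->; by [constructor 1|constructor 2|constructor 3].
Qed.

Section ThreePebbles.
Variables G H : graph.
Variable Q : nat -> G -> H -> G -> H -> Prop.
Hypothesis Q_atom : forall k x x' y y', Q k x x' y y' ->
  (x == y) = (x' == y') /\ adj x y = adj x' y'.
Hypothesis Q_sym : forall k x x' y y', Q k x x' y y' -> Q k y y' x x'.
Hypothesis Q_diag : forall k x x' y y', Q k x x' y y' -> Q k y y' y y'.
Hypothesis Q_mono : forall k x x' y y', Q k.+1 x x' y y' -> Q k x x' y y'.
Hypothesis forth : forall k x x' y y', Q k.+1 x x' y y' ->
  forall z, exists2 z', Q k x x' z z' & Q k y y' z z'.
Hypothesis back : forall k x x' y y', Q k.+1 x x' y y' ->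
  forall z', exists2 z, Q k x x' z z' & Q k y y' z z'.

(** Lifting one of three pebbles leaves two, so a reply that is good against two matched pairs
    suffices. In a good position [Q] holds between all pebbles; at the start they all lie on [x] and
    [x']. *)
Lemma three_pebbles p x x' : sentence p -> nvars p <= 3 ->
  Q (qrank p) x x' x x' -> (models G p <-> models H p).
Proof.
move=> sp np hQ; rewrite (models_sat (fun=> x) sp) (models_sat (fun=> x') sp).
set V := undup (vars p).
pose I k (e : nat -> G) (e' : nat -> H) :=
  {in V &, forall i j, Q k (e i) (e' i) (e j) (e' j)}.
have uV : uniq V by rewrite undup_uniq.
have ext k e e' i j l z z' : I k.+1 e e' ->
    {in V, forall t, [\/ t = i, t = j | t = l]} -> j \in V -> l \in V ->
    Q k (e j) (e' j) z z' -> Q k (e l) (e' l) z z' ->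
    I k [eta e with i |-> z] [eta e' with i |-> z'].
  move=> hI hV jV lV hj hl s t sV tV /=.
  have old r : r \in V -> r != i -> Q k (e r) (e' r) z z'.
    by move=> /hV [] -> //; rewrite eqxx.
  case: (eqVneq s i) => si; case: (eqVneq t i) => ti.
  - exact: Q_diag hj.
  - exact/Q_sym/old.
  - exact: old.
  - exact/Q_mono/hI.
rewrite (@game_sat G H V I _ _ _ p (qrank p) (fun=> x) (fun=> x')) //.
- by move=> k e e' hI i j iV jV; apply: Q_atom (hI i j iV jV).
- move=> k e e' hI i z iV; have [j [l [jV lV hV]]] := others3 uV np iV.
  by have [z' h1 h2] := forth (hI j l jV lV) z; exists z'; apply: ext hI hV jV lV h1 h2.
- move=> k e e' hI i z iV; have [j [l [jV lV hV]]] := others3 uV np iV.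
  by have [z' h1 h2] := back (hI j l jV lV) z; exists z'; apply: ext hI hV jV lV h1 h2.
- by move=> t; rewrite mem_undup.
Qed.
End ThreePebbles.

Definition one_extendable (G : graph) := forall (x : G) (a : bool),
  exists2 z, x != z & adj x z = a.

(** With one pebble left on the board, Duplicator only has to copy equality and adjacency to a
    single vertex. *)
Lemma two_pebbles (G H : graph) p : one_extendable G -> one_extendable H ->
  sentence p -> nvars p <= 2 -> (models G p <-> models H p).
Proof.
move=> eG eH sp np.
have [x _] := card_gt0P (vertex_gt0 G); have [x' _] := card_gt0P (vertex_gt0 H).
rewrite (models_sat (fun=> x) sp) (models_sat (fun=> x') sp).
set V := undup (vars p).
pose I (k : nat) (e : nat -> G) (e' : nat -> H) :=
  {in V &, forall i j,
    (e i == e j) = (e' i == e' j) /\ adj (e i) (e j) = adj (e' i) (e' j)}.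
have uV : uniq V by rewrite undup_uniq.
have ext k e e' i j z z' : I k.+1 e e' ->
    {in V, forall t, t = i \/ t = j} -> j \in V ->
    (e j == z) = (e' j == z') -> adj (e j) z = adj (e' j) z' ->
    I k [eta e with i |-> z] [eta e' with i |-> z'].
  move=> hI hV jV he ha s t sV tV /=.
  case: (eqVneq s i) => si; case: (eqVneq t i) => ti.
  - by rewrite !eqxx !adj_irr.
  - case: (hV t tV) => [/eqP|->]; first by rewrite (negPf ti).
    by rewrite adj_sym [adj z' _]adj_sym eq_sym [z' == _]eq_sym.
  - by case: (hV s sV) => [/eqP|->]; rewrite ?(negPf si).
  - exact: hI.
have ex1 (G1 H1 : graph) (x1 z : G1) (x2 : H1) : one_extendable H1 ->
    exists z', (x1 == z) = (x2 == z') /\ adj x1 z = adj x2 z'.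
  move=> e1; case: (eqVneq x1 z) => [<-|_]; first by exists x2; rewrite eqxx !adj_irr.
  by have [z' /negPf h1 h2] := e1 x2 (adj x1 z); exists z'; rewrite h1 h2.
rewrite (@game_sat G H V I _ _ _ p (qrank p) (fun=> x) (fun=> x')) //.
- move=> k e e' hI i z iV; have [j jV hV] := others2 uV np iV.
  by have [z' [h1 h2]] := ex1 _ _ (e j) z (e' j) eH; exists z'; apply: ext hI hV jV h1 h2.
- move=> k e e' hI i z iV; have [j jV hV] := others2 uV np iV.
  have [z' [h1 h2]] := ex1 _ _ (e' j) z (e j) eG.
  by exists z'; apply: ext hI hV jV _ _.
- by move=> t; rewrite mem_undup.
- by move=> i j _ _; rewrite !eqxx !adj_irr.
Qed.

(** The reply depends on the atomic type of the two standing pebbles alone; if this holds in both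
    directions, Duplicator can play for ever and no rounds need be counted. *)
Definition one_step (G H : graph) := forall (x y : G) (x' y' : H),
  (x == y) = (x' == y') -> adj x y = adj x' y' -> forall z, exists z',
  [/\ (x == z) = (x' == z'), (y == z) = (y' == z'),
      adj x z = adj x' z' & adj y z = adj y' z'].

Lemma one_step_equiv (G H : graph) p : one_step G H -> one_step H G ->
  sentence p -> nvars p <= 3 -> (models G p <-> models H p).
Proof.
move=> GH HG sp np.
have [x _] := card_gt0P (vertex_gt0 G); have [x' _] := card_gt0P (vertex_gt0 H).
apply: (@three_pebbles G H (fun _ x x' y y' =>
  (x == y) = (x' == y') /\ adj x y = adj x' y') _ _ _ _ _ _ p x x' sp np) => //.
- move=> _ u u' v v' [h1 h2].
  by rewrite adj_sym [adj v' _]adj_sym eq_sym [v' == _]eq_sym.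
- by move=> *; rewrite !eqxx !adj_irr.
- move=> _ u u' v v' [h1 h2] z; have [z' [? ? ? ?]] := GH _ _ _ _ h1 h2 z.
  by exists z'.
- move=> _ u u' v v' [h1 h2] z.
  have [z' [? ? ? ?]] := HG _ _ _ _ (esym h1) (esym h2) z.
  by exists z'.
- by rewrite !eqxx !adj_irr.
Qed.

Lemma distinguishes_neq (G H : graph) p :
  (models G p <-> models H p) -> ~ distinguishes p G H.
Proof. rewrite /distinguishes; tauto. Qed.

(** * From pairs of graphs to the width parameters *)

Section Assembly.
Variables (F : graph) (k : nat).

(** The first hypothesis bounds every pair by [k]; the second supplies, for every [s], a pair that
    attains [k]. So the maximum is [k] at every degree of connectivity, and so is its minimum over
    [s]. *)
Lemma Wstar_intro :
  (forall G H, induced_copy F G -> ~ induced_copy F H -> exists p,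
     [/\ sentence p, nvars p <= k & distinguishes p G H]) ->
  (forall s, exists G H, [/\ induced_copy F G, ~ induced_copy F H,
     s_connected s G, s_connected s H & forall p, sentence p -> nvars p < k ->
     (models G p <-> models H p)]) ->
  Wstarkappa_is F k /\ Wstar_is F k.
Proof.
move=> U L.
have LW s : exists G H, [/\ induced_copy F G, ~ induced_copy F H,
     s_connected s G, s_connected s H & W_pair_is G H k].
  have [G [H [FG FH cG cH eq]]] := L s; exists G, H; split=> //.
  have low m : (exists p, [/\ sentence p, nvars p = m & distinguishes p G H]) ->
      k <= m.
    case=> p [sp <- dp]; rewrite leqNgt; apply/negP => /(eq p sp).
    by move/distinguishes_neq; apply.
  split=> //; have [p [sp np dp]] := U G H FG FH; exists p; split=> //.
  by apply/eqP; rewrite eqn_leq np; apply: low; exists p.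
have UW G H m : induced_copy F G -> ~ induced_copy F H -> W_pair_is G H m -> m <= k.
  move=> FG FH [_ mmin]; have [p [sp np dp]] := U G H FG FH.
  by apply: leq_trans np; apply: mmin; exists p.
split; split.
- exists 0; split; first exact: LW.
  by move=> m [G [H [FG FH _ _ /(UW _ _ _ FG FH)]]].
- by move=> m [s [_]]; apply; apply: LW.
- by have [G [H [FG FH _ _ h]]] := LW 0; exists G, H.
- by move=> m [G [H [FG FH /(UW _ _ _ FG FH)]]].
Qed.

(** Here [G] and [H] may depend on the sentence [q], whereas in [Wstar_intro] one pair must defeat
    all sentences. This difference separates the two parameters for [P4]. *)
Lemma W_intro p : sentence p -> nvars p = k ->
  (forall G : graph, models G p <-> induced_copy F G) ->
  (forall s q, sentence q -> nvars q < k -> exists G H,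
     [/\ induced_copy F G, ~ induced_copy F H, s_connected s G, s_connected s H &
         models G q <-> models H q]) ->
  Wkappa_is F k /\ W_is F k.
Proof.
move=> sp np pF L.
have low q s : sentence q -> (forall G, s_connected s G ->
    (models G q <-> induced_copy F G)) -> k <= nvars q.
  move=> sq qF; rewrite leqNgt; apply/negP => /(L s q sq) [G [H [FG FH cG cH]]].
  by rewrite (qF G cG) (qF H cH); tauto.
split; split.
- by exists p, 0; split.
- by move=> m [q [s [sq <- qF]]]; apply: low sq qF.
- by exists p.
- by move=> m [q [sq <- qF]]; apply: (low q 0) => // G _.
Qed.

Lemma W_Wstar_intro p : sentence p -> nvars p = k ->
  (forall G : graph, models G p <-> induced_copy F G) ->
  (forall s, exists G H, [/\ induced_copy F G, ~ induced_copy F H,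
     s_connected s G, s_connected s H & forall p, sentence p -> nvars p < k ->
     (models G p <-> models H p)]) ->
  Wstarkappa_is F k /\ W_is F k.
Proof.
move=> sp np pF L; split.
  apply: (proj1 (Wstar_intro _ L)) => G H FG FH; exists p; rewrite np; split=> //.
  by left; rewrite !pF.
apply: (proj2 (W_intro sp np pF _)) => s q sq nq.
have [G [H [? ? ? ? h]]] := L s; exists G, H; split=> //; exact: h.
Qed.
End Assembly.

Lemma avoid_family (T : finType) s (g : 'I_s -> T) (S : {set T}) :
  injective g -> #|S| < s -> exists i, g i \notin S.
Proof.
move=> gi cS; have: ~~ ([set g i | i : 'I_s] \subset S).
  apply: contraL cS => /subset_leq_card.
  by rewrite card_imset // card_ord -leqNgt.
by case/subsetPn=> _ /imsetP[i _ ->]; exists i.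
Qed.

(** Fewer than [s] deletions spare one of the [s] common neighbours, so non-adjacent vertices stay
    joined by a path of length two. *)
Lemma connected_by_common_neighbours (G : graph) s : s < #|G| ->
  (forall x y : G, x != y -> ~~ adj x y -> exists2 g : 'I_s -> G, injective g &
     forall i, adj x (g i) && adj (g i) y) ->
  s_connected s G.
Proof.
move=> sG h; split=> // S cS x y xS yS.
case: (eqVneq x y) => [->|/h{}h]; first exact: connect0.
case: (boolP (adj x y)) => [xy|/h[g gi hg]].
  by apply: connect1; rewrite /adj_off /= xS yS.
have [i iS] := avoid_family gi cS; case/andP: (hg i) => h1 h2.
by apply: (@connect_trans _ _ (g i)); apply: connect1; rewrite /adj_off /= ?xS ?yS ?iS.
Qed.

(** * Four-vertex patterns and rook's graphs *)

Definition listed (es : seq (nat * nat)) i j := ((i, j) \in es) || ((j, i) \in es).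

Definition spans (es : seq (nat * nat)) (G : graph) (a b c d : G) :=
  uniq [:: a; b; c; d] &&
  [&& adj a b == listed es 0 1, adj a c == listed es 0 2,
      adj a d == listed es 0 3, adj b c == listed es 1 2,
      adj b d == listed es 1 3 & adj c d == listed es 2 3].

Lemma induced_copy4P es (G : graph) : induced_copy (graph4 es) G <->
  exists a b c d : G, spans es a b c d.
Proof.
pose o0 := @Ordinal 4 0 isT; pose o1 := @Ordinal 4 1 isT.
pose o2 := @Ordinal 4 2 isT; pose o3 := @Ordinal 4 3 isT.
split=> [[f fi fa]|[a [b [c [d]]]]].
  exists (f o0), (f o1), (f o2), (f o3).
  by rewrite /spans /= !inE !(inj_eq fi) !fa /= /edge_rel /= !eqxx.
case/andP=> abcd /and5P[/eqP ab /eqP ac /eqP ad /eqP bc /andP[/eqP bd /eqP cd]].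
pose f (i : 'I_4) := nth a [:: a; b; c; d] i; exists f => i j.
  by move=> /eqP; rewrite nth_uniq ?size_tuple ?ltn_ord // => /eqP /val_inj.
case: i => [[|[|[|[|?]]]] ?] //; case: j => [[|[|[|[|?]]]] ?] //;
  rewrite /f /= /edge_rel /= ?adj_irr -?val_eqE //= ?eqxx //=;
  by [|rewrite adj_sym orbC].
Qed.

Definition literal es i j :=
  FAnd (FNot (FEq i j)) (if listed es i j then FAdj i j else FNot (FAdj i j)).

(** One variable per vertex: this gives the upper bound 4 for every pattern on four vertices. *)
Definition copy_sentence es := FEx 0 (FEx 1 (FEx 2 (FEx 3
  (FAnd (literal es 0 1) (FAnd (literal es 0 2) (FAnd (literal es 0 3)
  (FAnd (literal es 1 2) (FAnd (literal es 1 3) (literal es 2 3))))))))).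

Lemma sat_literal (G : graph) (e : nat -> G) es i j :
  sat e (literal es i j) = (e i != e j) && (adj (e i) (e j) == listed es i j).
Proof. by rewrite /=; case: (listed es i j) => /=; [rewrite eqb_id|rewrite eqbF_neg]. Qed.

Lemma sat_and (G : graph) (e : nat -> G) p q : sat e (FAnd p q) = sat e p && sat e q.
Proof. by []. Qed.

Lemma sat_exP (G : graph) (e : nat -> G) i p :
  reflect (exists v, sat [eta e with i |-> v] p) (sat e (FEx i p)).
Proof. exact: existsP. Qed.

Lemma sentence_copy es : sentence (copy_sentence es).
Proof. by rewrite /sentence /=; do 6 case: listed. Qed.

Lemma nvars_copy es : nvars (copy_sentence es) = 4.
Proof. by rewrite /nvars /=; do 6 case: listed. Qed.

Lemma models_copy es (G : graph) :
  models G (copy_sentence es) <-> induced_copy (graph4 es) G.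
Proof.
case/card_gt0P: (vertex_gt0 G) => v _.
rewrite (models_sat (fun=> v) (sentence_copy es)) induced_copy4P; split.
  case/sat_exP=> a /sat_exP[b /sat_exP[c /sat_exP[d h]]]; exists a, b, c, d.
  move: h; rewrite !(sat_literal, sat_and) /spans /= !inE !negb_or.
  by do ![case/andP=> /andP[-> ->]]; case/andP=> -> ->.
case=> a [b [c [d h]]]; apply/sat_exP; exists a; apply/sat_exP; exists b.
apply/sat_exP; exists c; apply/sat_exP; exists d.
move: h; rewrite !(sat_literal, sat_and) /spans /= !inE !negb_or.
case/andP=> /and4P[/and3P[-> -> ->] /andP[-> ->] -> _].
by case/and5P=> -> -> -> -> /andP[-> ->].
Qed.

Lemma exists_notin (T : finType) (s : seq T) : size s < #|T| -> exists x, x \notin s.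
Proof.
move=> h; apply/existsP; apply: contraTT h => /existsPn h.
rewrite -leqNgt; apply: leq_trans (card_size s).
by apply: subset_leq_card; apply/subsetP => x _; move: (h x); rewrite negbK.
Qed.

(** The extension axiom for two vertices. Three pebbles see no difference between graphs with more
    than one vertex that satisfy it. *)
Definition full (G : graph) := forall (x y : G) (a b : bool), x != y ->
  exists z, [/\ x != z, y != z, adj x z = a & adj y z = b].

Lemma full_one_extendable (G : graph) : 1 < #|G| -> full G -> one_extendable G.
Proof.
move=> G1 fG x a; have [y] : exists y, y \notin [:: x] by apply: exists_notin.
rewrite inE eq_sym => xy; have [z [? _ ? _]] := fG x y a a xy; by exists z.
Qed.

Lemma full_one_step (G H : graph) : 1 < #|H| -> full H -> one_step G H.
Proof.
move=> H1 fH x y x' y' exy axy z.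
case: (eqVneq x z) => [<-|xz].
  by exists x'; rewrite !eqxx !adj_irr eq_sym [y' == _]eq_sym adj_sym [adj y' _]adj_sym.
case: (eqVneq y z) xz => [<-|yz] xz.
  by exists y'; rewrite !eqxx !adj_irr -exy -axy (negPf xz).
(* [full] speaks of distinct vertices only; coinciding pebbles need the one-vertex version. *)
case: (eqVneq x y) exy => [xy|xy] /esym.
  move/eqP=> xy'; subst y y'; have [z' /negPf h1 h2] := full_one_extendable H1 fH x' (adj x z).
  by exists z'; rewrite h1 h2.
move/negbT=> /(fH x' y' (adj x z) (adj y z)) [z' [/negPf h1 /negPf h2 h3 h4]].
by exists z'; rewrite h1 h2 h3 h4.
Qed.

(** * Rook's graphs and their complements *)

Section Grids.
Variable m : nat.
Let cell : finType := ('I_m.+1 * 'I_m.+1)%type.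

Definition rook_rel : rel cell :=
  [rel x y | (x != y) && ((x.1 == y.1) || (x.2 == y.2))].

Lemma rook_sym : symmetric rook_rel.
Proof. by move=> x y; rewrite /rook_rel /= eq_sym (eq_sym x.1) (eq_sym x.2). Qed.

Lemma rook_irr : irreflexive rook_rel.
Proof. by move=> x; rewrite /rook_rel /= eqxx. Qed.

(** The complement of the rook's graph, which is the tensor product of two complete graphs. *)
Definition corook_rel : rel cell := [rel x y | (x.1 != y.1) && (x.2 != y.2)].

Lemma corook_sym : symmetric corook_rel.
Proof. by move=> x y; rewrite /corook_rel /= (eq_sym x.1) (eq_sym x.2). Qed.

Lemma corook_irr : irreflexive corook_rel.
Proof. by move=> x; rewrite /corook_rel /= eqxx. Qed.

Lemma cell_gt0 : 0 < #|cell|.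
Proof. by rewrite card_prod card_ord. Qed.

Definition rook := Graph rook_sym rook_irr cell_gt0.
Definition corook := Graph corook_sym corook_irr cell_gt0.

Lemma card_cell_gt s : s <= m -> 0 < m -> s < #|cell|.
Proof. by rewrite card_prod !card_ord; nia. Qed.

Lemma ord_avoid (s : seq 'I_m.+1) : size s <= m -> exists i, i \notin s.
Proof. by move=> h; apply: exists_notin; rewrite card_ord. Qed.

(** Three rows and columns provide a row [r] and a column [c] that miss both cells. The wanted cell
    is where these lines cross each other or the lines through the given cells; the table depends on
    whether the cells share a row, a column or neither. *)
Lemma rook_full : 1 < m -> full rook.
Proof.
move=> m2 [i j] [k l] a b; rewrite xpair_eqE negb_and => xy.
have [c] := @ord_avoid [:: j; l] m2.
rewrite !inE !(eq_sym c) negb_or => /andP[/negPf cj /negPf cl].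
have [r] := @ord_avoid [:: i; k] m2.
rewrite !inE !(eq_sym r) negb_or => /andP[/negPf ri /negPf rk].
have adjE (u v : rook) : adj u v = (u != v) && ((u.1 == v.1) || (u.2 == v.2)) by [].
suff [z hz] : exists z : rook, [&& (i, j) != z, (k, l) != z,
    adj ((i, j) : rook) z == a & adj ((k, l) : rook) z == b].
  by exists z; case/and4P: hz => ? ? /eqP ? /eqP ?.
have [ik|/negPf ik] := eqVneq i k; last have [jl|/negPf jl] := eqVneq j l.
- subst k; rewrite eqxx /= in xy; move/negPf in xy.
  have yx : (l == j) = false by rewrite eq_sym.
  by case: a b => [] []; [exists (i, c)|exists (r, j)|exists (r, l)|exists (r, c)];
  rewrite !adjE !xpair_eqE /= !(cj, cl, ri, rk, xy, yx, eqxx).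
- subst l; have ki : (k == i) = false by rewrite eq_sym.
  by case: a b => [] []; [exists (r, j)|exists (i, c)|exists (k, c)|exists (r, c)];
  rewrite !adjE !xpair_eqE /= !(cj, cl, ri, rk, ik, ki, eqxx).
- have ki : (k == i) = false by rewrite eq_sym.
  have lj : (l == j) = false by rewrite eq_sym.
  by case: a b => [] []; [exists (i, l)|exists (i, c)|exists (k, c)|exists (r, c)];
  rewrite !adjE !xpair_eqE /= !(cj, cl, ri, rk, ik, ki, jl, lj, eqxx).
Qed.

(** The extension axiom is invariant under complementation, which negates [a] and [b]. *)
Lemma corook_full : 1 < m -> full corook.
Proof.
move=> m2 x y a b xy; have [z [xz yz ax ay]] := rook_full m2 (~~ a) (~~ b) xy.
have h (u : corook) c : u != z -> adj (u : rook) z = ~~ c -> adj u z = c.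
  by rewrite /= /rook_rel /corook_rel /= => ->; rewrite -negb_or /= => ->; rewrite negbK.
by exists z; split=> //; apply: h.
Qed.

(* Fewer than [m] deletions leave a whole row untouched, and every cell sees it. *)
Lemma rook_connected s : s <= m -> 0 < m -> s_connected s rook.
Proof.
move=> sm m0; split=> [|S cS x y xS yS]; first exact: card_cell_gt.
have [r] : exists r, r \notin [seq u.1 | u <- enum S].
  by apply: exists_notin; rewrite size_map -cardE card_ord; apply: leq_trans cS (leqW sm).
move=> hr; have rS j : (r, j) \notin S.
  by apply: contra hr => h; apply/mapP; exists (r, j); rewrite ?mem_enum.
have step (u v : rook) : u \notin S -> v \notin S ->
    (u.1 == v.1) || (u.2 == v.2) -> connect (adj_off S) u v.
  move=> uS vS h; case: (eqVneq u v) => [->|uv]; first exact: connect0.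
  by apply: connect1; rewrite /adj_off /= uS vS /rook_rel /= uv.
apply: (@connect_trans _ _ (r, x.2)); first by apply: step; rewrite //= eqxx orbT.
apply: (@connect_trans _ _ (r, y.2)); apply: step; rewrite //= eqxx ?orbT //.
Qed.

Lemma corook_connected s : s <= m -> 1 < m -> s_connected s corook.
Proof.
move=> sm m1; apply: connected_by_common_neighbours => [|x y].
  by apply: card_cell_gt => //; apply: ltnW.
move=> _; rewrite negb_and !negbK => /orP[] /eqP exy.
  have [c] := @ord_avoid [:: x.2; y.2] m1.
  rewrite !inE negb_or => /andP[c1 c2].
  (* [lift x.1] enumerates the rows other than the common row of [x] and [y]; the column [c] avoids
     both cells. *)
  exists (fun i : 'I_s => (lift x.1 (widen_ord sm i), c)).
    by move=> i j /(congr1 fst) /lift_inj [] /ord_inj.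
  move=> i; rewrite /= /corook_rel /= -exy neq_lift (eq_sym _ c) c1 c2 /=.
  by rewrite eq_sym neq_lift.
have [c] := @ord_avoid [:: x.1; y.1] m1.
rewrite !inE negb_or => /andP[c1 c2].
exists (fun i : 'I_s => (c, lift x.2 (widen_ord sm i))).
  by move=> i j /(congr1 snd) /lift_inj [] /ord_inj.
move=> i; rewrite /= /corook_rel /= -exy neq_lift (eq_sym _ c) c1 c2 /=.
by rewrite eq_sym neq_lift.
Qed.

(** The neighbours of a cell lie on two lines, each of them a clique, so two of any three neighbours
    share a line. *)
Lemma rook_claw_free : ~ induced_copy claw rook.
Proof.
case/induced_copy4P=> -[a1 a2] [[b1 b2] [[c1 c2] [[d1 d2]]]].
rewrite /spans /= /rook_rel /= !inE !negb_or !xpair_eqE /= !eqbF_neg !eqb_id.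
case/andP=> /and4P[_ /andP[bc bd] cd _].
case/and5P=> /andP[_ ab] /andP[_ ac] /andP[_ ad]; rewrite bc bd cd /= => bc' /andP[bd' cd'].
have nc : ~~ [|| b1 == c1, b2 == c2, b1 == d1, b2 == d2, c1 == d1 | c2 == d2].
  by move: bc' bd' cd'; rewrite !negb_or; do 3 case/andP=> -> ->.
move: nc {bc bd cd bc' bd' cd'}.
by case/orP: ab => /eqP <-; case/orP: ac => /eqP <-; case/orP: ad => /eqP <-;
  rewrite !eqxx ?orbT.
Qed.

(** Two adjacent cells span one line, which contains all their common neighbours; these are
    therefore adjacent to each other. *)
Lemma rook_diamond_free : ~ induced_copy diamond rook.
Proof.
case/induced_copy4P=> -[a1 a2] [[b1 b2] [[c1 c2] [[d1 d2]]]].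
rewrite /spans /= /rook_rel /= !inE !negb_or !xpair_eqE /= !eqbF_neg !eqb_id.
case/andP=> /and4P[/and3P[nab nac nad] /andP[nbc nbd] ncd _].
case/and5P=> /andP[_ ab] /andP[_ ac] /andP[_ ad] /andP[_ bc] /andP[/andP[_ bd]].
rewrite ncd /= => cd; case/orP: ab => /eqP e; subst.
  have {}nab : a2 != b2 by move: nab; rewrite eqxx.
  have line (u v : 'I_m.+1) : ~~ ((b1 == u) && (a2 == v)) ->
      (b1 == u) || (a2 == v) -> (b1 == u) || (b2 == v) -> b1 = u.
    by case: eqP => //= _ _ /eqP <-; rewrite eq_sym (negPf nab).
  by move: cd; rewrite -(line _ _ nac ac bc) -(line _ _ nad ad bd) eqxx.
have {}nab : a1 != b1 by move: nab; rewrite eqxx andbT.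
have line (u v : 'I_m.+1) : ~~ ((a1 == u) && (b2 == v)) ->
    (a1 == u) || (b2 == v) -> (b1 == u) || (b2 == v) -> b2 = v.
  case: (b2 =P v) => //= _ _; rewrite !orbF => /eqP <-.
  by rewrite eq_sym (negPf nab).
by move: cd; rewrite -(line _ _ nac ac bc) -(line _ _ nad ad bd) eqxx orbT.
Qed.

(** Coordinates up to 3 exist on every board with at least four rows, so a copy is certified by
    evaluating a boolean on numbers. *)
Lemma corook_copy es (l : seq (nat * nat)) : 2 < m ->
  let c i := nth (0, 0) l i in
  let e i j := ((c i).1 != (c j).1) && ((c i).2 != (c j).2) in
  [&& uniq [:: c 0; c 1; c 2; c 3], all (fun u => (u.1 <= 3) && (u.2 <= 3)) l,
    size l == 4 &
    [&& e 0 1 == listed es 0 1, e 0 2 == listed es 0 2,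
      e 0 3 == listed es 0 3, e 1 2 == listed es 1 2,
      e 1 3 == listed es 1 3 & e 2 3 == listed es 2 3]] ->
  induced_copy (graph4 es) corook.
Proof.
move=> m3; case: l => [|[a a'] [|[b b'] [|[c c'] [|[d d'] []]]]] //=;
  rewrite ?andbF //; last by move=> ? ?; rewrite !andbF.
case/and3P=> u; case/and5P=> /andP[ha ha'] /andP[hb hb'] /andP[hc hc'] /andP[hd hd'] _ h.
apply/induced_copy4P; exists (inord a, inord a'), (inord b, inord b').
exists (inord c, inord c'), (inord d, inord d').
move: u h; rewrite /spans /= /corook_rel /= !inE !negb_or !xpair_eqE -!val_eqE /=.
by rewrite !inordK ?ltnS ?(leq_trans _ m3) // => -> ->.
Qed.

End Grids.

Lemma corook_paw m : 2 < m -> induced_copy paw (corook m).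
Proof.
by move=> m3; apply: (@corook_copy _ _ [:: (0, 0); (1, 1); (2, 2); (0, 1)]).
Qed.

Lemma corook_P4 m : 2 < m -> induced_copy P4 (corook m).
Proof.
by move=> m3; apply: (@corook_copy _ _ [:: (0, 1); (1, 2); (0, 0); (1, 1)]).
Qed.

Lemma corook_claw m : 2 < m -> induced_copy claw (corook m).
Proof.
by move=> m3; apply: (@corook_copy _ _ [:: (1, 3); (0, 0); (0, 1); (0, 2)]).
Qed.

Lemma corook_diamond m : 2 < m -> induced_copy diamond (corook m).
Proof.
by move=> m3; apply: (@corook_copy _ _ [:: (1, 2); (2, 3); (0, 0); (0, 1)]).
Qed.

(** * Multipartite graphs, cones and the paw *)

Section Multipartite.
Variables c m : nat.
Let part_vertex : finType := ('I_c.+1 * 'I_m.+1)%type.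

Definition multipartite_rel : rel part_vertex := [rel x y | x.1 != y.1].

Lemma multipartite_sym : symmetric multipartite_rel.
Proof. by move=> x y; rewrite /multipartite_rel /= eq_sym. Qed.

Lemma multipartite_irr : irreflexive multipartite_rel.
Proof. by move=> x; rewrite /multipartite_rel /= eqxx. Qed.

Lemma part_vertex_gt0 : 0 < #|part_vertex|.
Proof. by rewrite card_prod !card_ord. Qed.

Definition multipartite := Graph multipartite_sym multipartite_irr part_vertex_gt0.

Lemma multipartite_connected s : 0 < c -> s <= m -> s_connected s multipartite.
Proof.
move=> c0 sm; apply: connected_by_common_neighbours => [|x y].
  by rewrite card_prod !card_ord; nia.
move=> _; rewrite negbK => /eqP exy.
have [d] : exists d, d \notin [:: x.1] by apply: exists_notin; rewrite card_ord.
rewrite inE => dx; exists (fun i : 'I_s => (d, widen_ord (leqW sm) i)).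
  by move=> i j [] /ord_inj.
by move=> i; rewrite /= /multipartite_rel /= -exy eq_sym dx.
Qed.

Lemma multipartite_one_extendable : 0 < c -> 0 < m -> one_extendable multipartite.
Proof.
move=> c0 m0 [i j] a.
have [d] : exists d, d \notin [:: i] by apply: exists_notin; rewrite card_ord.
have [l] : exists l, l \notin [:: j] by apply: exists_notin; rewrite card_ord.
rewrite !inE !(eq_sym _ i) !(eq_sym _ j) => lj di.
by case: a; [exists (d, j)|exists (i, l)];
  rewrite /= /multipartite_rel /= ?eqxx ?xpair_eqE ?negb_and ?lj ?di ?orbT.
Qed.
End Multipartite.

(** The reply goes to the part of [x'], to the part of [y'] or to a third part. [1 < c'] supplies
    the third part and [1 < m] an unpebbled vertex in a given part; hence three pebbles cannot tell
    four parts from three. *)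
Lemma multipartite_one_step c c' m : 1 < c' -> 1 < m ->
  one_step (multipartite c m) (multipartite c' m).
Proof.
move=> c1 m1 x y x' y' exy; rewrite /= /multipartite_rel /= => /negb_inj axy z.
have [d] : exists d, d \notin [:: x'.1; y'.1] by apply: exists_notin; rewrite card_ord.
have [l] : exists l, l \notin [:: x'.2; y'.2] by apply: exists_notin; rewrite card_ord.
rewrite !inE !negb_or !(eq_sym d) !(eq_sym l).
move=> /andP[/negPf lx /negPf ly] /andP[/negPf dx /negPf dy].
case: (eqVneq x z) => [<-|xz].
  by exists x'; rewrite !eqxx eq_sym (eq_sym y') (eq_sym y.1) (eq_sym y'.1) exy axy.
case: (eqVneq y z) xz => [<-|yz] xz; first by exists y'; rewrite !eqxx -exy (negPf xz) axy.
have pE (T U : eqType) (u v : T * U) : (u == v) = (u.1 == v.1) && (u.2 == v.2) by [].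
case: (eqVneq x.1 z.1) => [xz1|xz1].
  exists (x'.1, l); rewrite eqxx !pE /= lx ly !andbF.
  by rewrite -xz1 (eq_sym y.1) axy (eq_sym y'.1).
case: (eqVneq y.1 z.1) => [yz1|yz1].
  exists (y'.1, l); rewrite eqxx !pE /= lx ly !andbF.
  by rewrite -axy yz1 (negPf xz1).
by exists (d, l); rewrite !pE /= dx dy.
Qed.

Lemma multipartite_K4 m : induced_copy K4 (multipartite 3 m).
Proof.
exists (fun i : K4 => ((i : 'I_4), ord0 : 'I_m.+1)) => [i j []//|i j].
rewrite /= /multipartite_rel /edge_rel /=.
by case: i => [[|[|[|[|?]]]] ?] //; case: j => [[|[|[|[|?]]]] ?].
Qed.

(** The four vertices of a clique lie in different parts, and there are only three parts. *)
Lemma multipartite_K4_free m : ~ induced_copy K4 (multipartite 2 m).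
Proof.
case=> f _ fa; have /leq_card : injective (fun i => (f i).1).
  move=> i j eij; move: (fa i j); rewrite /= /multipartite_rel /= eij eqxx /edge_rel /=.
  case: eqVneq => //= ij.
  by move: ij; case: i {eij} => [[|[|[|[|?]]]] ?] //; case: j => [[|[|[|[|?]]]] ?].
by rewrite !card_ord.
Qed.

Lemma bipartite_paw_free m : ~ induced_copy paw (multipartite 1 m).
Proof.
case/induced_copy4P=> -[a ?] [[b ?] [[c ?] [[d ?]]]].
rewrite /spans /= /multipartite_rel /= => /andP[_].
by move: a b c d => [[|[|?]] ?] [[|[|?]] ?] [[|[|?]] ?] [[|[|?]] ?].
Qed.

Lemma bipartite_P4_free m : ~ induced_copy P4 (multipartite 1 m).
Proof.
case/induced_copy4P=> -[a ?] [[b ?] [[c ?] [[d ?]]]].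
rewrite /spans /= /multipartite_rel /= => /andP[_].
by move: a b c d => [[|[|?]] ?] [[|[|?]] ?] [[|[|?]] ?] [[|[|?]] ?].
Qed.

(** * Cones: adding universal vertices *)

Section Cone.
Variables (s : nat) (G : graph).
Let cone_vertex : finType := (G + 'I_s)%type.

Definition cone_rel : rel cone_vertex := fun x y =>
  match x, y with inl u, inl v => adj u v | _, _ => x != y end.

Lemma cone_sym : symmetric cone_rel.
Proof. by move=> [u|i] [v|j] /=; rewrite 1?eq_sym //; apply: adj_sym. Qed.

Lemma cone_irr : irreflexive cone_rel.
Proof. by move=> [u|i] /=; rewrite ?eqxx //; apply: adj_irr. Qed.

Lemma cone_gt0 : 0 < #|cone_vertex|.
Proof. by rewrite card_sum addn_gt0 vertex_gt0. Qed.

Definition cone := Graph cone_sym cone_irr cone_gt0.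

Lemma cone_connected : s_connected s cone.
Proof.
apply: connected_by_common_neighbours => [|x y].
  by rewrite card_sum card_ord -[X in X < _]add0n ltn_add2r vertex_gt0.
case: x y => [u|i] [v|j] //= xy; rewrite /= ?negbK ?(negPf xy) //.
by move=> _; exists (fun i : 'I_s => inr i : cone) => // i j [].
Qed.
End Cone.

(* Apex vertices are universal, hence lie in no induced 4-cycle. *)
Lemma cone_C4_free s (G : graph) : ~ induced_copy C4 G -> ~ induced_copy C4 (cone s G).
Proof.
move=> nG /induced_copy4P [a [b [c [d]]]].
rewrite /spans /= !inE !negb_or.
case/andP=> /and4P[/and3P[ab ac ad] /andP[bc bd] cd _].
case/and5P=> ab' ac' ad' bc' /andP[bd' cd'].
have nonadj (u v : cone s G) : u != v -> cone_rel u v == false ->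
    exists u' v', u = inl u' /\ v = inl v'.
  by case: u v => [u|i] [v|j] //= h; [exists u, v|rewrite h..].
have [a1 [c1 [? ?]]] := nonadj _ _ ac ac'; have [b1 [d1 [? ?]]] := nonadj _ _ bd bd'.
subst; apply: nG; apply/induced_copy4P; exists a1, b1, c1, d1.
by rewrite /spans /= !inE !negb_or ab ac ad bc bd cd ab' ac' ad' bc' bd' cd'.
Qed.

Lemma cone_copy s (F G : graph) : induced_copy F G -> induced_copy F (cone s G).
Proof. by case=> f fi fa; exists (fun x => inl (f x) : cone s G) => // x y [] /fi. Qed.

(** Duplicator answers an apex by the same apex and otherwise follows the strategy between [G] and
    [H]. *)
Lemma cone_equiv s (G H : graph) p : one_step G H -> one_step H G ->
  sentence p -> nvars p <= 3 -> (models (cone s G) p <-> models (cone s H) p).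
Proof.
move=> GH HG sp np.
have [x _] := card_gt0P (vertex_gt0 G); have [x' _] := card_gt0P (vertex_gt0 H).
pose Q (_ : nat) (u : cone s G) (u' : cone s H)
    (v : cone s G) (v' : cone s H) :=
  match u, u', v, v' with
  | inl a, inl a', inl b, inl b' => (a == b) = (a' == b') /\ adj a b = adj a' b'
  | inl a, inl a', inr i, inr i' => i = i'
  | inr i, inr i', inl b, inl b' => i = i'
  | inr i, inr i', inr j, inr j' => i = i' /\ j = j'
  | _, _, _, _ => False
  end.
apply: (@three_pebbles (cone s G) (cone s H) Q _ _ _ _ _ _ p (inl x) (inl x') sp np) => //.
- move=> _ [a|i] [a'|i'] [b|j] [b'|j'] //=; last by case=> -> ->.
- move=> _ [a|i] [a'|i'] [b|j] [b'|j'] //=; last by case=> -> ->.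
  by rewrite eq_sym adj_sym (eq_sym b') (adj_sym b').
- move=> _ [a|i] [a'|i'] [b|j] [b'|j'] //=;
    by [rewrite !eqxx !adj_irr|move=> ->|case=> _ ->].
- have st (a b z : G) (a' b' : H) : (a == b) = (a' == b') /\ adj a b = adj a' b' ->
     exists z', ((a == z) = (a' == z') /\ adj a z = adj a' z') /\
                ((b == z) = (b' == z') /\ adj b z = adj b' z').
    by case=> h1 h2; have [z' [? ? ? ?]] := GH _ _ _ _ h1 h2 z; exists z'.
  have di (a : G) (a' : H) : (a == a) = (a' == a') /\ adj a a = adj a' a'.
    by rewrite !eqxx !adj_irr.
  move=> _ [a|i] [a'|i'] [b|j] [b'|j'] //= h [z|t].
  + by have [z' [? ?]] := st _ _ z _ _ h; exists (inl z').
  + by exists (inr t).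
  + by have [z' [? ?]] := st _ _ z _ _ (di a a'); exists (inl z').
  + by exists (inr t).
  + by have [z' [? ?]] := st _ _ z _ _ (di b b'); exists (inl z').
  + by exists (inr t).
  (* When both standing pebbles are apexes, every vertex of [H] is a correct reply. *)
  + by exists (inl x'); case: h.
  + by exists (inr t); case: h.
- have st (a b z : H) (a' b' : G) : (a' == b') = (a == b) /\ adj a' b' = adj a b ->
     exists z', ((a' == z') = (a == z) /\ adj a' z' = adj a z) /\
                ((b' == z') = (b == z) /\ adj b' z' = adj b z).
    case=> h1 h2; have [z' [? ? ? ?]] := HG _ _ _ _ (esym h1) (esym h2) z.
    by exists z'.
  have di (a : H) (a' : G) : (a' == a') = (a == a) /\ adj a' a' = adj a a.
    by rewrite !eqxx !adj_irr.
  move=> _ [a|i] [a'|i'] [b|j] [b'|j'] //= h [z|t].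
  + by have [z' [? ?]] := st _ _ z _ _ h; exists (inl z').
  + by exists (inr t).
  + by have [z' [? ?]] := st _ _ z _ _ (di a' a); exists (inl z').
  + by exists (inr t).
  + by have [z' [? ?]] := st _ _ z _ _ (di b' b); exists (inl z').
  + by exists (inr t).
  + by exists (inl x); case: h.
  + by exists (inr t); case: h.
- by rewrite /= !eqxx !adj_irr.
Qed.

(** * Triangle-free graphs with an extension property *)

Definition triangle_free (G : graph) := forall x y z : G,
  adj x z -> adj y z -> ~~ adj x y.

(** The extension axiom as far as triangle-freeness permits: only a common neighbour of an edge is
    excluded. The case [x = y], with [a = b], covers coinciding pebbles. *)
Definition triangle_free_full (G : graph) := forall (x y : G) (a b : bool),
  ~~ [&& adj x y, a & b] -> (x == y) ==> (a == b) ->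
  exists z, [&& x != z, y != z, adj x z == a & adj y z == b].

Lemma triangle_free_one_step (G H : graph) :
  triangle_free G -> triangle_free_full H -> one_step G H.
Proof.
move=> tG fH x y x' y' exy axy z.
case: (eqVneq x z) => [<-|xz].
  by exists x'; rewrite !eqxx !adj_irr eq_sym [y' == _]eq_sym adj_sym [adj y' _]adj_sym.
case: (eqVneq y z) xz => [<-|yz] xz.
  by exists y'; rewrite !eqxx !adj_irr -exy -axy (negPf xz).
have [||z' /and4P[/negPf h1 /negPf h2 /eqP h3 /eqP h4]] := fH x' y' (adj x z) (adj y z).
- rewrite -axy; apply/negP => /and3P[h1 h2 h3].
  by move: (tG _ _ _ h2 h3); rewrite h1.
- by rewrite -exy; apply/implyP => /eqP ->.
- by exists z'; rewrite h1 h2 h3 h4.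
Qed.

Section NatGraph.
Variables (n : nat) (r : rel nat).

(** The relation lives on [nat] so that the finite checks below run by evaluation over lists of
    numbers. *)
Definition sym_closure (i j : nat) := (i != j) && (r i j || r j i).
Definition nat_graph_rel : rel 'I_n.+1 := [rel i j | sym_closure (val i) (val j)].

Lemma nat_graph_sym : symmetric nat_graph_rel.
Proof. by move=> i j; rewrite /nat_graph_rel /= /sym_closure eq_sym orbC. Qed.

Lemma nat_graph_irr : irreflexive nat_graph_rel.
Proof. by move=> i; rewrite /nat_graph_rel /= /sym_closure eqxx. Qed.

Lemma nat_graph_gt0 : 0 < #|'I_n.+1|.
Proof. by rewrite card_ord. Qed.

Definition nat_graph := Graph nat_graph_sym nat_graph_irr nat_graph_gt0.

Let vs := iota 0 n.+1.

Lemma mem_vs (x : nat_graph) : val x \in vs.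
Proof. by rewrite mem_iota /= ltn_ord. Qed.

Lemma nat_graph_triangle_free :
  all (fun x => all (fun y => all (fun z =>
    ~~ [&& sym_closure x z, sym_closure y z & sym_closure x y]) vs) vs) vs ->
  triangle_free nat_graph.
Proof.
move=> h x y z xz yz.
have := allP (allP (allP h _ (mem_vs x)) _ (mem_vs y)) _ (mem_vs z).
by move: xz yz; rewrite /= /nat_graph_rel /= => -> ->.
Qed.

Lemma nat_graph_triangle_free_full :
  all (fun x => all (fun y => all (fun a => all (fun b =>
    ~~ [&& sym_closure x y, a & b] ==> ((x == y) ==> (a == b)) ==>
    has (fun z => [&& x != z, y != z, sym_closure x z == a & sym_closure y z == b]) vs)
    [:: true; false]) [:: true; false]) vs) vs ->
  triangle_free_full nat_graph.
Proof.
move=> h x y a b h1 h2.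
have inb (c : bool) : c \in [:: true; false] by case: c.
have /implyP/(_ h1)/implyP/(_ h2)/hasP[z zn hz] :=
  allP (allP (allP (allP h _ (mem_vs x)) _ (mem_vs y)) _ (inb a)) _ (inb b).
by rewrite mem_iota in zn; exists (Ordinal zn).
Qed.

Lemma nat_graph_C4_free :
  all (fun a => all (fun c => sym_closure a c || (a == c) ||
    all (fun b => all (fun d =>
      [&& b != d, sym_closure a b, sym_closure b c, sym_closure c d & sym_closure a d]
      ==> sym_closure b d) vs) vs) vs) vs ->
  ~ induced_copy C4 nat_graph.
Proof.
move=> h /induced_copy4P [a [b [c [d]]]].
rewrite /spans /= /nat_graph_rel /= !inE !negb_or -!val_eqE /=.
case/andP=> /and4P[/and3P[ab ac ad] /andP[bc bd] cd _].
case/and5P=> ab' ac' ad' bc' /andP[bd' cd'].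
have := allP (allP h _ (mem_vs a)) _ (mem_vs c).
rewrite (negPf ac) (eqP ac') !orFb.
move=> {}h; have := allP (allP h _ (mem_vs b)) _ (mem_vs d).
by rewrite bd (eqP ab') (eqP ad') (eqP bc') (eqP bd') (eqP cd').
Qed.
End NatGraph.

(* 0..4 is the outer pentagon, 5..9 the inner pentagram. *)
Definition petersen := nat_graph 9 (fun i j =>
  [|| [&& i < 5, j < 5 & j == i.+1 %% 5], (i < 5) && (j == i + 5)
    | [&& 5 <= i, 5 <= j & j - 5 == (i - 3) %% 5]]).

(* The circulant graph on Z/13 with connection set {1, 5, 8, 12};
   for [j < i] the truncated difference is 0. *)
Definition circulant13 := nat_graph 12 (fun i j => j - i \in [:: 1; 5; 8; 12]).

Lemma petersen_triangle_free : triangle_free petersen.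
Proof. by apply: nat_graph_triangle_free; vm_compute. Qed.
Lemma petersen_full : triangle_free_full petersen.
Proof. by apply: nat_graph_triangle_free_full; vm_compute. Qed.
Lemma petersen_C4_free : ~ induced_copy C4 petersen.
Proof. by apply: nat_graph_C4_free; vm_compute. Qed.
Lemma circulant13_triangle_free : triangle_free circulant13.
Proof. by apply: nat_graph_triangle_free; vm_compute. Qed.
Lemma circulant13_full : triangle_free_full circulant13.
Proof. by apply: nat_graph_triangle_free_full; vm_compute. Qed.
(** The steps +1, +5, -1, -5 close up to the cycle 0, 1, 6, 5; its diagonals have differences 6 and
    4, outside the connection set. *)
Lemma circulant13_C4 : induced_copy C4 circulant13.
Proof.
by apply/induced_copy4P; exists (inord 0), (inord 1), (inord 6), (inord 5);
  rewrite /spans /= /nat_graph_rel /= !inE -!val_eqE /= !inordK.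
Qed.

(** * The paw *)

Definition paw_sentence := FEx 0 (FEx 1 (FEx 2
  (FAnd (FAdj 0 1) (FAnd (FNot (FAdj 2 0)) (FAnd (FNot (FAdj 2 1))
  (FAnd (FEx 2 (FAnd (FAdj 2 0) (FAdj 2 1))) (FEx 1 (FAnd (FAdj 1 0) (FAdj 1 2))))))))).

(** The sentence provides a common neighbour [c] of [a], [b] and a common neighbour [c'] of [a],
    [d], possibly different because the variables are reused. Cases on whether [c'] sees [b], [c']
    sees [c] and [d] sees [c] always reveal a paw among these vertices. *)
Lemma models_paw (G : graph) : models G paw_sentence <-> induced_copy paw G.
Proof.
case/card_gt0P: (vertex_gt0 G) => v _.
rewrite (@models_sat _ paw_sentence (fun=> v)) // induced_copy4P; split.
  case/sat_exP=> a /sat_exP[b /sat_exP[d]]; rewrite !sat_and.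
  case/and5P=> /= ab nda ndb /existsP[c /= /andP[ca cb]] /existsP[c' /= /andP[ca' cd']].
  have spanP (x y z t : G) : adj x y -> adj x z -> adj y z -> ~~ adj x t -> ~~ adj y t ->
      adj z t -> exists a b c d : G, spans [:: (0, 1); (0, 2); (1, 2); (2, 3)] a b c d.
    move=> xy xz yz nxt nyt zt; exists x, y, z, t.
    have ne (p q r : G) : adj p r -> ~~ adj q r -> p != q.
      by move=> pr; apply: contraNneq => <-.
    have nadj (p q : G) : adj p q -> p != q.
      by apply: contraTneq => ->; rewrite adj_irr.
    rewrite /spans /= !inE !negb_or xy xz yz zt (negPf nxt) (negPf nyt).
    rewrite (nadj x y xy) (nadj x z xz) (nadj y z yz) (nadj z t zt).
    by rewrite (ne x t y) ?(ne y t x) // adj_sym.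
  have ac : adj a c by rewrite adj_sym.
  have bc : adj b c by rewrite adj_sym.
  have ac' : adj a c' by rewrite adj_sym.
  have nad : ~~ adj a d by rewrite adj_sym.
  have nbd : ~~ adj b d by rewrite adj_sym.
  have ba : adj b a by rewrite adj_sym.
  case: (boolP (adj c' b)) => [cb'|ncb'].
    by apply: (spanP a b c' d) => //; rewrite adj_sym.
  case: (boolP (adj c' c)) => [cc'|ncc']; last first.
    by apply: (spanP b c a c') => //; rewrite adj_sym.
  case: (boolP (adj d c)) => [dc|ndc].
    by apply: (spanP a b c d) => //; rewrite adj_sym.
  by apply: (spanP a c c' d) => //; rewrite adj_sym.
case=> a [b [c [d]]]; case/andP=> _ /and5P[/eqP ab /eqP ac /eqP ad /eqP bc /andP[/eqP bd /eqP cd]].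
apply/sat_exP; exists a; apply/sat_exP; exists b; apply/sat_exP; exists d.
rewrite !sat_and /= ab adj_sym ad adj_sym bd /=; apply/andP; split.
  by apply/existsP; exists c => /=; rewrite adj_sym ac adj_sym bc.
by apply/existsP; exists c => /=; rewrite adj_sym ac cd.
Qed.

Lemma paw_width : Wstarkappa_is paw 3 /\ W_is paw 3.
Proof.
apply: (@W_Wstar_intro paw 3 paw_sentence) => //; first exact: models_paw.
(* The shift by 3 gives a board of side at least four, which holds the cells of the copy. *)
move=> s; exists (corook (s + 3)), (multipartite 1 (s + 3)); split.
- by apply: corook_paw; rewrite addn3.
- exact: bipartite_paw_free.
- by apply: corook_connected; lia.
- by apply: multipartite_connected; lia.
- move=> p sp np; apply: two_pebbles => //.
    by apply: full_one_extendable; [apply: card_cell_gt|apply: corook_full]; lia.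
  by apply: multipartite_one_extendable; lia.
Qed.

(** * The patterns for which both parameters equal four *)

Lemma width4 es :
  (forall s, exists G H, [/\ induced_copy (graph4 es) G, ~ induced_copy (graph4 es) H,
     s_connected s G, s_connected s H & forall p, sentence p -> nvars p <= 3 ->
     (models G p <-> models H p)]) ->
  Wstarkappa_is (graph4 es) 4 /\ W_is (graph4 es) 4.
Proof.
exact: (W_Wstar_intro (sentence_copy es) (nvars_copy es) (@models_copy es)).
Qed.

Lemma K4_width : Wstarkappa_is K4 4 /\ W_is K4 4.
Proof.
apply: width4 => s; exists (multipartite 3 (s + 2)), (multipartite 2 (s + 2)); split.
- exact: multipartite_K4.
- exact: multipartite_K4_free.
- by apply: multipartite_connected; lia.
- by apply: multipartite_connected; lia.
- by move=> p; apply: one_step_equiv; apply: multipartite_one_step; lia.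
Qed.

Lemma C4_width : Wstarkappa_is C4 4 /\ W_is C4 4.
Proof.
apply: width4 => s; exists (cone s circulant13), (cone s petersen); split.
- exact/cone_copy/circulant13_C4.
- exact/cone_C4_free/petersen_C4_free.
- exact: cone_connected.
- exact: cone_connected.
- move=> p; apply: cone_equiv; apply: triangle_free_one_step.
  + exact: circulant13_triangle_free.
  + exact: petersen_full.
  + exact: petersen_triangle_free.
  + exact: circulant13_full.
Qed.

Lemma corook_rook_equiv m p : 1 < m -> sentence p -> nvars p <= 3 ->
  (models (corook m) p <-> models (rook m) p).
Proof.
move=> m1; apply: one_step_equiv; apply: full_one_step;
  by [apply: card_cell_gt; lia|exact: rook_full|exact: corook_full].
Qed.

Lemma claw_width : Wstarkappa_is claw 4 /\ W_is claw 4.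
Proof.
apply: width4 => s; exists (corook (s + 3)), (rook (s + 3)); split.
- by apply: corook_claw; lia.
- exact: rook_claw_free.
- by apply: corook_connected; lia.
- by apply: rook_connected; lia.
- by move=> p; apply: corook_rook_equiv; lia.
Qed.

Lemma diamond_width : Wstarkappa_is diamond 4 /\ W_is diamond 4.
Proof.
apply: width4 => s; exists (corook (s + 3)), (rook (s + 3)); split.
- by apply: corook_diamond; lia.
- exact: rook_diamond_free.
- by apply: corook_connected; lia.
- by apply: rook_connected; lia.
- by move=> p; apply: corook_rook_equiv; lia.
Qed.

(** * Three-variable separation of P4 from cographs *)

Section Refinement.
Variable G : graph.

(** Three steps, because [P4] and its complement both have diameter 3. *)
Definition comp3 (R : rel G) : rel G :=
  fun x y => [exists z, R x z && [exists w, R z w && R w y]].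

(** Both kinds of step may stand still; for [coadj_step] this follows from irreflexivity of
    [adj]. *)
Definition adj_step (R : rel G) : rel G := fun x y => R x y && ((x == y) || adj x y).
Definition coadj_step (R : rel G) : rel G := fun x y => R x y && ~~ adj x y.

(** A refinement of the set of all pairs: a pair survives a round if surviving pairs link it in at
    most three steps along edges, and also along non-edges. *)
Fixpoint linked (n : nat) : rel G :=
  if n is n'.+1 then fun x y =>
    comp3 (adj_step (linked n')) x y && comp3 (coadj_step (linked n')) x y
  else fun _ _ => true.

Lemma comp3_walk (R : rel G) (q : nat -> G) :
  (forall i j, i < 4 -> j < 4 -> i <= j.+1 -> j <= i.+1 -> R (q i) (q j)) ->
  forall i j, i < 4 -> j < 4 -> comp3 R (q i) (q j).
Proof.
move=> near i j i4 j4.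
(* [k l] is the index reached after [l] unit steps from [i] towards [j], resting at [j]; below 4,
   three steps are enough. *)
pose k l := if i <= j then minn (i + l) j else maxn (i - l) j.
apply/existsP; exists (q (k 1)); apply/andP; split.
  by apply: near; rewrite /k; case: (leqP i j); lia.
apply/existsP; exists (q (k 2)); apply/andP; split.
  by apply: near; rewrite /k; case: (leqP i j); lia.
by apply: near; rewrite /k; case: (leqP i j); lia.
Qed.

(** [P4] is self-complementary, so its vertices are linked both along edges and along non-edges, and
    all its pairs survive every round. *)
Lemma linked_P4 (a b c d : G) n : spans [:: (0, 1); (1, 2); (2, 3)] a b c d ->
  forall i j, i < 4 -> j < 4 ->
  linked n (nth a [:: a; b; c; d] i) (nth a [:: a; b; c; d] j).
Proof.
case/andP=> _ /and5P[/eqP ab /eqP ac /eqP ad /eqP bc /andP[/eqP bd /eqP cd]].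
set p := nth a _; elim: n => //= n IH i j i4 j4; apply/andP; split.
  apply: comp3_walk => // {}i {}j {}i4 {}j4 ij ji; rewrite /adj_step IH //=.
  by move: i j i4 j4 ij ji => [|[|[|[|?]]]] [|[|[|[|?]]]] //= _ _ _ _;
    rewrite /p /= ?eqxx // ?ab ?bc ?cd ?orbT // adj_sym ?ab ?bc ?cd ?orbT.
(* the complement of the path a b c d is the path b d a c *)
pose t := nth 0 [:: 1; 3; 0; 2]; pose u := nth 0 [:: 2; 0; 3; 1].
have tu l : l < 4 -> t (u l) = l by case: l => [|[|[|[|?]]]].
have t4 l : t l < 4 by case: l => [|[|[|[|?]]]] //; rewrite /t nth_default.
have u4 l : u l < 4 by case: l => [|[|[|[|?]]]] //; rewrite /u nth_default.
rewrite -(tu i) // -(tu j) //; apply: (@comp3_walk _ (p \o t)) => //.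
move=> {}i {}j {}i4 {}j4 ij ji; rewrite /coadj_step IH //=.
by move: i j i4 j4 ij ji => [|[|[|[|?]]]] [|[|[|[|?]]]] //= _ _ _ _;
  rewrite /p /t /= ?adj_irr // ?ad ?ac ?bd // adj_sym ?ad ?ac ?bd.
Qed.

Lemma comp3_closed (R : rel G) (Y : {set G}) :
  (forall x y, x \in Y -> R x y -> y \in Y) ->
  forall x y, x \in Y -> comp3 R x y -> y \in Y.
Proof.
move=> cY x y xY /existsP[z /andP[xz /existsP[w /andP[zw wy]]]].
exact: (cY _ _ (cY _ _ (cY _ _ xY xz) zw) wy).
Qed.

(** For [b = true] the set [X] is the join of [Y] and the rest, for [b = false] their disjoint
    union. *)
Definition homogeneous_cut (b : bool) (X Y : {set G}) :=
  [/\ Y \proper X, Y != set0 & forall y z, y \in Y -> z \in X -> z \notin Y -> adj y z = b].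

(** For [b = true] the path w, v, n, m lies in the complement, and the edges form the path n, w, m,
    v. *)
Lemma path_like_P4 b (w v n m : G) : uniq [:: w; v; n; m] ->
  [/\ adj w v = ~~ b, adj v n = ~~ b & adj n m = ~~ b] ->
  [/\ adj w n = b, adj w m = b & adj v m = b] -> induced_copy P4 G.
Proof.
move=> u [wv vn nm] [wn wm vm]; apply/induced_copy4P; case: b wv vn nm wn wm vm => /=
  wv vn nm wn wm vm; last first.
  by exists w, v, n, m; rewrite /spans u wv vn nm wn wm vm.
exists n, w, m, v; rewrite /spans (adj_sym n w) (adj_sym m v) (adj_sym n v).
rewrite wv vn nm wn wm vm /= andbT; move: u; rewrite /= !inE !negb_or !(eq_sym _ n) !(eq_sym _ v).
by case/and4P=> /and3P[-> -> ->] /andP[-> ->] ->.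
Qed.

(* Seinsche's theorem *)
Lemma P4_free_cut : ~ induced_copy P4 G ->
  forall n (X : {set G}), #|X| = n.+2 -> exists b Y, homogeneous_cut b X Y.
Proof.
move=> nP4; elim=> [|n IH] X cX.
  have /cards2P[u [v [uv ->]]] : #|X| == 2 by rewrite cX.
  exists (adj u v), [set u]; split.
  - by rewrite properE sub1set !inE eqxx /= subUset !sub1set !inE eqxx /= eq_sym (negPf uv).
  - by apply/set0Pn; exists u; rewrite inE.
  - by move=> y z; rewrite !inE => /eqP -> /orP[/eqP ->|/eqP ->]; rewrite ?eqxx.
(* Remove a vertex [v] and cut the remainder into [Y] and its complement. *)
have [v vX] : exists v, v \in X by apply/card_gt0P; rewrite cX.
have cX' : #|X :\ v| = n.+2 by have := cardsD1 v X; rewrite vX cX; lia.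
have {IH} [b [Y [YX Y0 hY]]] := IH _ cX'.
have vY : v \notin Y by apply/negP => /(subsetP (proper_sub YX)); rewrite !inE eqxx.
have sYX : {subset Y <= X} by move=> y /(subsetP (proper_sub YX)); rewrite !inE => /andP[].
have [_ [z1 z1X z1Y]] := properP YX; rewrite !inE in z1X; case/andP: z1X => z1v z1X.
have [y1 y1Y] := set0Pn _ Y0.
have hYZ y z : y \in Y -> z \in X -> z \notin Y -> z != v -> adj y z = b.
  by move=> yY zX zY zv; apply: hY => //; rewrite !inE zv.
have prop (Z : {set G}) u : {subset Z <= X} -> u \in X -> u \notin Z -> Z \proper X.
  by move=> sZ uX uZ; apply/properP; split; [apply/subsetP|exists u].
(* If [v] relates to all of [Y] by [b], it can be added to the other side. *)
case: (boolP [exists y in Y, adj v y == ~~ b]) => [/exists_inP[y0 y0Y /eqP vy0]|]; last first.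
  rewrite negb_exists_in => /forall_inP vb; exists b, Y; split=> //; first exact: prop vX vY.
  move=> y z yY zX zY; case: (eqVneq z v) => [->|zv]; last exact: hYZ.
  by move: (vb y yY); rewrite adj_sym; case: (adj y v) (b) => [] [].
(* The same with the two sides exchanged. Afterwards [v] has neighbours of type [~~ b] on both
   sides, [y0] and [z0]. *)
case: (boolP [exists z in X :\: Y :\ v, adj v z == ~~ b])
    => [/exists_inP[z0]|]; last first.
  rewrite negb_exists_in => /forall_inP vb; exists b, (X :\: Y :\ v); split.
  - by apply: (prop _ v) => // [u|]; rewrite !inE ?eqxx // => /and3P[].
  - by apply/set0Pn; exists z1; rewrite !inE z1v z1Y.
  move=> z y zZ yX; have := zZ; rewrite !inE => /and3P[zv zY zX].
  rewrite yX andbT negb_and !negbK => /orP[/eqP ->|yY].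
    by move: (vb z zZ); rewrite adj_sym; case: (adj z v) (b) => [] [].
  by rewrite adj_sym; apply: hYZ.
rewrite !inE => /and3P[z0v z0Y z0X] /eqP vz0.
(* [M] collects the neighbours of [v] of type [b]. If it is empty, [v] alone is a cut of type
   [~~ b]; otherwise [M] is a cut of type [b] unless some [m] in it and some [k] outside are related
   by [~~ b]. *)
pose M := [set w in X :\ v | adj v w == b].
have vM : v \notin M by rewrite !inE eqxx.
have sM : {subset M <= X} by move=> u; rewrite !inE => /andP[/andP[]].
case: (eqVneq M set0) => [M0|M0].
  exists (~~ b), [set v]; split.
  - by apply: (prop _ z1) => // [u|]; rewrite !inE // => /eqP ->.
  - by apply/set0Pn; exists v; rewrite inE.
  move=> y z; rewrite !inE => /eqP -> zX zv.
  have : z \notin M by rewrite M0 inE.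
  by rewrite !inE zX zv /=; case: (adj v z) (b) => [] [].
case: (boolP [exists m in M, [exists n in X :\: M :\ v, adj n m == ~~ b]]); last first.
  rewrite negb_exists_in => /forall_inP nM; exists b, M; split=> //; first exact: prop vX vM.
  move=> m k mM kX kM; case: (eqVneq k v) => [->|kv].
    by move: mM; rewrite !inE adj_sym => /andP[_ /eqP].
  have := nM m mM; rewrite negb_exists_in => /forall_inP/(_ k).
  rewrite in_setD1 kv in_setD kM kX adj_sym => /(_ isT); by case: (adj m k) (b) => [] [].
case/exists_inP=> m mM /exists_inP[k]; rewrite in_setD1 in_setD => /and3P[kv kM kX] /eqP km.
have vk : adj v k = ~~ b by move: kM; rewrite !inE kv kX; case: (adj v k) (b) => [] [].
move: (mM); rewrite !inE => /andP[/andP[mv mX] /eqP vm].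
have mk : m != k by apply: contraNneq kM => <-.
(* Pairs across the cut have type [b], so [k] and [m] lie on one side. Taking [w] among [y0], [z0]
   on the other side makes w, v, k, m a path of type [~~ b]. *)
have [w [wX wv vw wk]] : exists w, [/\ w \in X, w != v, adj v w = ~~ b & (w \in Y) != (k \in Y)].
  case: (boolP (k \in Y)) => kY; first by exists z0; rewrite z0X z0v vz0 (negPf z0Y).
  by exists y0; rewrite sYX // vy0 y0Y; split=> //; apply: contraNneq vY => <-.
have cross x y : x \in X -> y \in X -> x != v -> y != v -> (x \in Y) != (y \in Y) ->
    adj x y = b.
  move=> xX yX xv yv; case: (boolP (x \in Y)) => xY /=; case: (boolP (y \in Y)) => yY // _.
    exact: hYZ.
  by rewrite adj_sym; apply: hYZ.
have kmY : (k \in Y) = (m \in Y).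
  apply/eqP; apply: contraPT km => h; rewrite cross // => /esym.
  by case: (b).
have wkn : w != k by apply: contraNneq wk => ->.
have wm : w != m by apply: contraNneq wk => ->; rewrite kmY.
case: nP4; apply: (@path_like_P4 b w v k m).
- by rewrite /= !inE !negb_or wv wkn wm (eq_sym v) kv (eq_sym v) mv (eq_sym k) mk.
- by rewrite adj_sym vw vk km.
- by split; [exact: cross|apply: cross => //; rewrite -kmY|].
Qed.

Hypothesis nP4 : ~ induced_copy P4 G.

Lemma linked_trivial_on m : forall i (X : {set G}), #|X| <= m.+1 ->
  (forall x y, x \in X -> linked i x y -> y \in X) ->
  forall x y, x \in X -> linked (i + m) x y -> x = y.
Proof.
elim: m => [|m IH] i X cX clX x y xX xy.
  by rewrite addn0 in xy; apply: (card_le1_eqP cX) => //; apply: clX xX xy.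
rewrite addnS -addSn in xy.
case: (leqP #|X| m.+1) => [cX'|mX].
  apply: (IH i.+1 X) => // u v uX /= /andP[h _].
  by apply: comp3_closed uX h => {}u {}v uX /andP[/(clX _ _ uX)].
have cX' : #|X| = m.+2 by apply/eqP; rewrite eqn_leq cX mX.
have [b [Y [YX Y0 hY]]] := P4_free_cut nP4 cX'.
have sYX := subsetP (proper_sub YX).
have closed (Z : {set G}) : {subset Z <= X} ->
    (forall u v, u \in Z -> v \in X -> v \notin Z -> adj u v = b) ->
    forall u v, u \in Z -> linked i.+1 u v -> v \in Z.
  move=> sZ hZ u v uZ /= /andP[h1 h2].
  case: (b) hZ => hZ.
    apply: comp3_closed uZ h2 => u' v' u'Z /andP[uv nuv].
    apply: contraNT nuv => vZ; rewrite hZ //; exact: clX (sZ _ u'Z) uv.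
  apply: comp3_closed uZ h1 => u' v' u'Z /andP[uv /orP[/eqP <- //|auv]].
  apply: contraTT auv => vZ; rewrite hZ //; exact: clX (sZ _ u'Z) uv.
case: (boolP (x \in Y)) => xY.
  apply: (IH i.+1 Y) => //; last exact: closed.
  by have := proper_card YX; rewrite cX'.
apply: (IH i.+1 (X :\: Y)) => //; last 1 first.
- by rewrite inE xY.
- rewrite cardsD (setIidPr (proper_sub YX)) cX'.
  by move: Y0; rewrite -card_gt0; lia.
apply: closed => [u|u v]; rewrite !inE; first by case/andP.
move=> /andP[uY uX] vX; rewrite vX andbT negbK => vY.
by rewrite adj_sym; apply: hY.
Qed.

Lemma linked_trivial (x y : G) : linked #|G| x y -> x = y.
Proof.
apply: (@linked_trivial_on #|G| 0 setT) => //.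
by rewrite cardsT.
Qed.
End Refinement.

(* [k] is the spare variable; permuting the three names keeps every stage
   within three variables. *)
Definition comp3_formula (X : nat -> nat -> nat -> formula) i j k :=
  FEx k (FAnd (X i k j) (FEx i (FAnd (X k i j) (X i j k)))).

(** At stage 0, [FEq i i] stands for truth. *)
Fixpoint linked_formula n i j k :=
  if n is n'.+1 then
    FAnd (comp3_formula (fun i j k => FAnd (linked_formula n' i j k)
            (FOr (FEq i j) (FAdj i j))) i j k)
         (comp3_formula (fun i j k => FAnd (linked_formula n' i j k)
            (FNot (FAdj i j))) i j k)
  else FEq i i.

Definition linked_sentence n :=
  FEx 0 (FEx 1 (FAnd (FNot (FEq 0 1)) (linked_formula n 0 1 2))).

Lemma sat_comp3 (G : graph) (R : rel G) X :
  (forall i j k (e : nat -> G), uniq [:: i; j; k] -> sat e (X i j k) = R (e i) (e j)) ->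
  forall i j k (e : nat -> G), uniq [:: i; j; k] ->
  sat e (comp3_formula X i j k) = comp3 R (e i) (e j).
Proof.
move=> XR i j k e; rewrite /= !inE negb_or => /and3P[/andP[ij ik] jk _].
have [ji [ki kj]] : j != i /\ k != i /\ k != j by rewrite !(eq_sym _ i) (eq_sym k) ij ik jk.
apply: eq_existsb => z; rewrite XR /= ?inE ?negb_or ?ij ?ik ?jk ?kj ?ji ?ki //.
rewrite eqxx (negPf ik); congr andb; apply: eq_existsb => w.
rewrite !XR /= ?inE ?negb_or ?ij ?ik ?jk ?kj ?ji ?ki //.
by rewrite !eqxx (negPf ki) (negPf ji) (negPf jk).
Qed.

Lemma sat_linked (G : graph) n i j k (e : nat -> G) : uniq [:: i; j; k] ->
  sat e (linked_formula n i j k) = linked n (e i) (e j).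
Proof.
elim: n i j k e => [|n IH] i j k e u; first exact: eqxx.
rewrite sat_and (@sat_comp3 _ (adj_step (linked n))) //; last first.
  by move=> i' j' k' e' u'; rewrite sat_and IH.
rewrite (@sat_comp3 _ (coadj_step (linked n))) //.
by move=> i' j' k' e' u'; rewrite sat_and IH.
Qed.

Lemma vars_and p q : vars (FAnd p q) = vars p ++ vars q.
Proof. by []. Qed.

Lemma free_vars_and p q : free_vars (FAnd p q) = free_vars p ++ free_vars q.
Proof. by []. Qed.

Lemma vars_comp3 X :
  (forall i j k, {subset vars (X i j k) <= [:: i; j; k]}) ->
  forall i j k, {subset vars (comp3_formula X i j k) <= [:: i; j; k]}.
Proof.
move=> h i j k t; rewrite /= !(inE, mem_cat).
by case/or3P=> [->|/h|/or3P[->|/h|/h]]; rewrite ?orbT // !inE => /or3P[] ->; rewrite ?orbT.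
Qed.

Lemma vars_linked n i j k : {subset vars (linked_formula n i j k) <= [:: i; j; k]}.
Proof.
elim: n i j k => [|n IH] i j k t; first by rewrite !inE => /orP[] ->.
rewrite [linked_formula _ _ _ _]/= vars_and mem_cat => /orP[];
  apply: vars_comp3 => {t}i' j' k' t; rewrite /= !(mem_cat, inE).
  by case/orP=> [/IH|/or4P[]]; rewrite ?inE // => ->; rewrite ?orbT.
by case/orP=> [/IH|/orP[]]; rewrite ?inE // => ->; rewrite ?orbT.
Qed.

Lemma free_vars_comp3 X :
  (forall i j k, {subset free_vars (X i j k) <= [:: i; j]}) ->
  forall i j k, {subset free_vars (comp3_formula X i j k) <= [:: i; j]}.
Proof.
move=> h i j k t; rewrite /= !(inE, mem_cat, mem_filter) => /andP[tk].
case/orP=> [/h|/andP[ti /orP[] /h]]; rewrite !inE ?(negPf tk) ?(negPf ti) ?orbF //.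
by move=> ->.
Qed.

Lemma free_vars_linked n i j k : {subset free_vars (linked_formula n i j k) <= [:: i; j]}.
Proof.
elim: n i j k => [|n IH] i j k t; first by rewrite !inE => /orP[] ->.
rewrite [linked_formula _ _ _ _]/= free_vars_and mem_cat => /orP[];
  apply: free_vars_comp3 => {t}i' j' k' t;
  rewrite /= !(mem_cat, inE).
  by case/orP=> [/IH|/or4P[]]; rewrite ?inE // => ->; rewrite ?orbT.
by case/orP=> [/IH|/orP[]]; rewrite ?inE // => ->; rewrite ?orbT.
Qed.

Lemma sentence_linked n : sentence (linked_sentence n).
Proof.
apply/eqP; rewrite -size_eq0 -leqn0 leqNgt -has_predT; apply/hasPn => t.
rewrite /linked_sentence /= !(mem_filter, inE) => /and3P[t0 t1 /free_vars_linked].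
by rewrite !inE (negPf t0) (negPf t1).
Qed.

Lemma nvars_linked n : nvars (linked_sentence n) <= 3.
Proof.
apply: (@uniq_leq_size _ _ [:: 0; 1; 2]); first exact: undup_uniq.
move=> t; rewrite mem_undup /linked_sentence /=.
by rewrite !inE => /or4P[->|->|->|/orP[->|/vars_linked]]; rewrite ?orbT // !inE.
Qed.

Lemma models_linked n (G : graph) : models G (linked_sentence n) <->
  exists x y : G, x != y /\ linked n x y.
Proof.
case/card_gt0P: (vertex_gt0 G) => v _.
rewrite (models_sat (fun=> v) (sentence_linked n)); split.
  case/sat_exP=> x /sat_exP[y]; rewrite sat_and sat_linked // => /andP[xy h].
  by exists x, y.
case=> x [y [xy h]]; apply/sat_exP; exists x; apply/sat_exP; exists y.
by rewrite sat_and sat_linked //; apply/andP.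
Qed.

(** In [H] only equal vertices remain linked after [#|H|] rounds, while a path in [G] survives them
    all. The sentence depends on the order of [H], so it gives no bound for a uniform definition. *)
Lemma P4_distinguished (G H : graph) : induced_copy P4 G -> ~ induced_copy P4 H ->
  exists p, [/\ sentence p, nvars p <= 3 & distinguishes p G H].
Proof.
move=> GP HP; exists (linked_sentence #|H|).
split; [exact: sentence_linked|exact: nvars_linked|left; rewrite !models_linked].
split=> [|[x [y [xy /(linked_trivial HP)]]]]; last by apply/eqP.
have [a [b [c [d s]]]] := (induced_copy4P _ _).1 GP.
exists a, b; split; last exact: (linked_P4 #|H| s (i := 0) (j := 1)).
by case/andP: s => /=; rewrite inE negb_or => /andP[/andP[]].
Qed.

Lemma P4_star_width : Wstarkappa_is P4 3 /\ Wstar_is P4 3.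
Proof.
apply: Wstar_intro => [G H|s]; first exact: P4_distinguished.
exists (corook (s + 3)), (multipartite 1 (s + 3)); split.
- by apply: corook_P4; lia.
- exact: bipartite_P4_free.
- by apply: corook_connected; lia.
- by apply: multipartite_connected; lia.
- move=> p sp np; apply: two_pebbles => //.
    by apply: full_one_extendable; [apply: card_cell_gt|apply: corook_full]; lia.
  by apply: multipartite_one_extendable; lia.
Qed.

(** * Word graphs *)

Section Words.
Variable N : nat.
Notation word := (N.-tuple 'I_4).
Implicit Types x y z : word.

Definition letter x i : 'I_4 := nth ord0 x i.

(* Equals [N] when the words coincide. *)
Definition split_level x y := find (fun i => letter x i != letter y i) (iota 0 N).

Definition set_letter x e (c : 'I_4) : word :=
  [tuple if val i == e then c else tnth x i | i < N].

Lemma letter_set x e c i : i < N -> letter (set_letter x e c) i = if i == e then c else letter x i.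
Proof.
move=> iN; rewrite /letter -[i]/(val (Ordinal iN)) -tnth_nth tnth_mktuple /=.
by rewrite (tnth_nth ord0).
Qed.

Lemma letter_inj x y : (forall i, i < N -> letter x i = letter y i) -> x = y.
Proof.
by move=> h; apply: val_inj; apply: (@eq_from_nth _ ord0); rewrite !size_tuple // => i; apply: h.
Qed.

Lemma split_levelxx x : split_level x x = N.
Proof.
rewrite /split_level -[RHS](size_iota 0); apply/eqP; rewrite eqn_leq find_size /= leqNgt.
by rewrite -has_find; apply/hasPn => i _; rewrite eqxx.
Qed.

Lemma split_level_before x y i : i < split_level x y -> letter x i = letter y i.
Proof.
move=> h; have iN : i < N by apply: leq_trans h _; rewrite -[N](size_iota 0) find_size.
by have := before_find 0 h; rewrite nth_iota // add0n => /negbFE /eqP.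
Qed.

Lemma split_level_lt x y : (split_level x y < N) = (x != y).
Proof.
apply/idP/idP => [|xy]; first by apply: contraTneq => ->; rewrite split_levelxx ltnn.
rewrite ltnNge; apply: contra xy => h; apply/eqP/letter_inj => i iN.
by apply: split_level_before; apply: leq_trans h.
Qed.

Lemma split_level_at x y : x != y ->
  letter x (split_level x y) != letter y (split_level x y).
Proof.
rewrite -split_level_lt => h; have := h; rewrite -[ltnRHS](size_iota 0) -has_find.
by move/(nth_find 0); rewrite nth_iota // add0n.
Qed.

Lemma split_level_eq x y e : e < N -> (forall i, i < e -> letter x i = letter y i) ->
  letter x e != letter y e -> split_level x y = e.
Proof.
move=> eN h1 h2; case: (ltngtP (split_level x y) e) => // h.
  have xy : x != y by rewrite -split_level_lt; apply: ltn_trans eN.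
  by move: (split_level_at xy); rewrite h1 // eqxx.
by move: h2; rewrite (split_level_before h) eqxx.
Qed.

Lemma split_levelC x y : split_level x y = split_level y x.
Proof. by apply: eq_find => i; rewrite eq_sym. Qed.

(** The ultrametric law of the word tree: [y] and [z] agree up to and including the place where [x]
    leaves [y]. *)
Lemma split_level_ultra x y z : split_level x y < split_level y z ->
  split_level x z = split_level x y.
Proof.
move=> h; have xy : x != y.
  by rewrite -split_level_lt; apply: leq_trans h _; rewrite -[N](size_iota 0) find_size.
apply: split_level_eq => [|i hi|]; first by rewrite split_level_lt.
  by rewrite (split_level_before hi); apply: split_level_before; apply: ltn_trans h.
by rewrite -(split_level_before h); apply: split_level_at.
Qed.

Lemma split_level_set x e c : e < N -> letter x e != c ->
  split_level x (set_letter x e c) = e.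
Proof.
move=> eN h; apply: split_level_eq => // [i ie|]; rewrite letter_set ?eqxx //.
  by rewrite (ltn_eqF ie).
exact: ltn_trans eN.
Qed.

Variable R : nat -> rel 'I_4.
Hypothesis R_sym : forall i, symmetric (R i).

(** This is the iterated lexicographic product of the graphs that [R 0], [R 1], ... define on the
    four letters. *)
Definition word_rel : rel word := fun x y => (x != y) &&
  R (split_level x y) (letter x (split_level x y)) (letter y (split_level x y)).

Lemma word_sym : symmetric word_rel.
Proof. by move=> x y; rewrite /word_rel eq_sym split_levelC R_sym. Qed.

Lemma word_irr : irreflexive word_rel.
Proof. by move=> x; rewrite /word_rel eqxx. Qed.

Lemma word_gt0 : 0 < #|{: word}|.
Proof. by rewrite card_tuple card_ord expn_gt0. Qed.

Definition word_graph := Graph word_sym word_irr word_gt0.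
End Words.

(** A normal level is a join of four blocks if it is even and a disjoint union if it is odd. *)
Definition normal_at (R : nat -> rel 'I_4) i := forall a b, a != b -> R i a b = ~~ odd i.

Lemma word_adj_normal N R (Rs : forall i, symmetric (R i)) (x y : word_graph N Rs) :
  normal_at R (split_level x y) -> adj x y = (x != y) && ~~ odd (split_level x y).
Proof. by move=> h; rewrite /= /word_rel; case: eqVneq => //= xy; rewrite h ?split_level_at. Qed.

(* At every level of the word tree the graph is a disjoint union or a join. *)
Lemma word_P4_free N R (Rs : forall i, symmetric (R i)) :
  (forall i, normal_at R i) -> ~ induced_copy P4 (word_graph N Rs).
Proof.
move=> nR /induced_copy4P [a [b [c [d]]]].
rewrite /spans /= !inE !negb_or => /andP[/and4P[/and3P[ab ac ad] /andP[bc bd] cd _]].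
have lev (x y : word_graph N Rs) : x != y -> word_rel R x y = ~~ odd (split_level x y).
  by move=> xy; have := word_adj_normal (nR (split_level x y)); rewrite xy.
rewrite !lev //; case/and5P=> /eqP h1 /eqP h2 /eqP h3 /eqP h4 /andP[/eqP h5 /eqP h6].
have ultra (x y z : word_graph N Rs) :
    split_level x y < split_level y z -> split_level x z = split_level x y.
  exact: split_level_ultra.
have C (x y : word_graph N Rs) : split_level x y = split_level y x by exact: split_levelC.
have par p q : ~~ odd p = true -> ~~ odd q = false -> p <> q.
  by move=> hp hq e; move: hp; rewrite e hq.
move: (ultra a b c) (ultra c b a) (ultra a c b) (ultra b c d) (ultra d c b) (ultra b d c)
  (ultra a b d) (par _ _ h1 h2) (par _ _ h4 h2) (par _ _ h4 h5) (par _ _ h6 h5) (par _ _ h1 h3).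
rewrite (C c b) (C b a) (C c a) (C d c) (C d b).
move: (split_level a b) (split_level a c) (split_level a d) (split_level b c)
  (split_level b d) (split_level c d).
clear=> AB AC AD BC BD CD abc cba acb bcd dcb bdc abd n1 n2 n3 n4 n5.
(* Edges have even and non-edges odd levels, and the least level in a triangle occurs twice. Hence
   consecutive edges of the path share one level, and the non-edge between its ends would have that
   level too. *)
have eB : AB = BC by case: (ltngtP AB BC) => // [/abc|/cba] e; [case: n1|case: n2].
have eC : BC = CD by case: (ltngtP BC CD) => // [/bcd|/dcb] e; [case: n3|case: n4].
by case: n5; rewrite abd //; case: (ltngtP AB BD) => // [h|e];
  [case: n3; rewrite bdc // -eC -eB|case: n3; rewrite -eB].
Qed.

(** Level 0 is a join, so non-adjacent words share their first letter and see every word that starts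
    differently. *)
Lemma word_connected N R (Rs : forall i, symmetric (R i)) s :
  normal_at R 0 -> s < N -> s_connected s (word_graph N Rs).
Proof.
move=> nR sN; have N0 : 0 < N by apply: leq_ltn_trans sN.
apply: connected_by_common_neighbours => [|x y xy nxy].
  rewrite card_tuple card_ord; apply: ltn_trans sN _; exact: ltn_expl.
have exy : letter x 0 = letter y 0.
  apply: contraNeq nxy => h; rewrite word_adj_normal (split_level_eq N0 _ h) //.
  by rewrite xy.
have [c] : exists c, c \notin [:: letter x 0] by apply: exists_notin; rewrite card_ord.
rewrite inE eq_sym => cx.
(* [o] is [c] followed by zeros. Changing one later letter yields [s] distinct words starting with
   [c], for which [s < N] leaves room. *)
have [o o0 oi] : exists2 o : N.-tuple 'I_4, letter o 0 = c &
    forall i, 0 < i -> i < N -> letter o i = ord0.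
  exists (set_letter [tuple ord0 | i < N] 0 c); first by rewrite letter_set.
  case=> // i _ iN; rewrite letter_set //= /letter.
  by rewrite -[i.+1]/(val (Ordinal iN)) -tnth_nth tnth_mktuple.
exists (fun i : 'I_s => set_letter o i.+1 ord_max) => [i j|i].
  move=> /(congr1 (fun w => letter w i.+1)); have iN : i.+1 < N by apply: leq_ltn_trans sN.
  rewrite !letter_set // eqxx eqSS; case: eqVneq => [/ord_inj //|_].
  by rewrite oi // => /(congr1 val).
have h0 : letter (set_letter o i.+1 ord_max) 0 = c by rewrite letter_set.
have adj0 (u v : word_graph N Rs) : letter u 0 != letter v 0 -> adj u v.
  move=> h; have uv : u != v by apply: contraNneq h => ->.
  by rewrite word_adj_normal (split_level_eq N0 _ h) // uv.
by rewrite !adj0 ?h0 ?cx // -exy eq_sym.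
Qed.

Lemma word_adj_ultra N R (Rs : forall i, symmetric (R i)) (x y z : word_graph N Rs) :
  split_level x y < split_level y z -> adj x z = adj x y.
Proof.
move=> h; rewrite /= /word_rel -!split_level_lt (split_level_ultra h).
by rewrite (split_level_before h).
Qed.

(** Two consecutive levels offer both adjacencies, which is why the margins in [mid] shrink by 2 in
    each round. *)
Lemma parity_choice (e : nat) (a : bool) :
  exists e', [/\ e <= e', e' <= e.+1 & ~~ odd e' = a].
Proof.
case: (eqVneq (~~ odd e) a) => h; first by exists e.
by exists e.+1; split=> //=; move: h; case: (odd e) a => [] [].
Qed.

(** * Duplicator's strategy on word graphs *)

Section WordGame.
Variables (N M r : nat).
Hypotheses (rM : 2 * r + 2 <= M) (MN : M + 2 * r + 2 < N).

Definition mid k e := (2 * k <= e) && (e + 2 * k < N).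

(* Within [k] rounds Spoiler can measure the depth of a splitting level only up
   to [2 * k], from the top or from the bottom of the word tree. *)
Definition word_match (R R' : nat -> rel 'I_4) (Rs : forall i, symmetric (R i))
    (Rs' : forall i, symmetric (R' i)) k (x : word_graph N Rs) (x' : word_graph N Rs')
    (y : word_graph N Rs) (y' : word_graph N Rs') :=
  [/\ k <= r, (x == y) = (x' == y'), adj x y = adj x' y' &
     x != y -> split_level x y = split_level x' y' \/
       mid k (split_level x y) && mid k (split_level x' y')].

Section Rel.
Variable R : nat -> rel 'I_4.
Hypothesis Rs : forall i, symmetric (R i).
Hypothesis nR : forall i, i != M -> normal_at R i.
Implicit Types x y z : word_graph N Rs.

Lemma branch x e : e < N -> e != M ->
  exists z, [/\ x != z, split_level x z = e & adj x z = ~~ odd e].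
Proof.
move=> eN eM.
have [c] : exists c, c \notin [:: letter x e] by apply: exists_notin; rewrite card_ord.
rewrite inE eq_sym => cx; have lz := split_level_set eN cx.
have xz : x != set_letter x e c by rewrite -split_level_lt lz.
by exists (set_letter x e c); rewrite word_adj_normal lz ?xz //; apply: nR.
Qed.

Lemma branch2 x y : x != y -> split_level x y != M -> exists z,
  [/\ x != z, y != z, split_level x z = split_level x y,
      split_level y z = split_level x y &
      adj x z = adj x y /\ adj y z = adj x y].
Proof.
move=> xy dM; have := split_level_at xy; have := xy; rewrite -split_level_lt.
move ed : (split_level x y) => d dN dxy; rewrite ed in dM.
have [c] : exists c, c \notin [:: letter x d; letter y d].
  by apply: exists_notin; rewrite card_ord.
rewrite !inE negb_or !(eq_sym c) => /andP[cx cy].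
have lz := split_level_set dN cx.
have ly : split_level y (set_letter x d c) = d.
  apply: split_level_eq => // [i id|]; rewrite letter_set ?eqxx //; last exact: ltn_trans dN.
  by rewrite (ltn_eqF id) (split_level_before (y := y)) // ed.
have xz : x != set_letter x d c by rewrite -split_level_lt lz.
have yz : y != set_letter x d c by rewrite -split_level_lt ly.
exists (set_letter x d c); split=> //.
by rewrite !word_adj_normal ?lz ?ly ?ed ?xz ?yz ?xy //; apply: nR.
Qed.

(** A branching at the exceptional level [M] is imitated at [M - 2] or [M - 1], whichever has the
    right parity; the margins around [M] keep it within [mid k]. *)
Lemma level_below k x z : k <= r -> x != z -> exists e', [/\ e' != M, e' < N,
  ~~ odd e' = adj x z, e' <= split_level x z &
  split_level x z = e' \/ mid k (split_level x z) && mid k e'].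
Proof.
move=> kr xz; have := xz; rewrite -split_level_lt => eN.
case: (eqVneq (split_level x z) M) => eM; last first.
  exists (split_level x z); split=> //; last by left.
  by rewrite word_adj_normal ?xz //; apply: nR.
have [e [e1 e2 eo]] := parity_choice (M - 2) (adj x z).
by exists e; rewrite eM eo /mid; split; by [lia|right; lia|].
Qed.

(** Here [M + 1] or [M + 2] replaces [M], for replies that must stay deeper than a given split. *)
Lemma level_above k x z : k <= r -> x != z -> exists e', [/\ e' != M, e' < N,
  ~~ odd e' = adj x z, split_level x z <= e' &
  split_level x z = e' \/ mid k (split_level x z) && mid k e'].
Proof.
move=> kr xz; have := xz; rewrite -split_level_lt => eN.
case: (eqVneq (split_level x z) M) => eM; last first.
  exists (split_level x z); split=> //; last by left.
  by rewrite word_adj_normal ?xz //; apply: nR.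
have [e [e1 e2 eo]] := parity_choice M.+1 (adj x z).
by exists e; rewrite eM eo /mid; split; by [lia|right; lia|].
Qed.

(** For [a = b], [z] branches off before [x] and [y] split. Otherwise one of the two values is
    [adj x y], and [z] branches off deep below the split, next to the vertex that needs the other
    value. *)
Lemma deep_extension k x y a b : k.+1 <= r -> x != y -> mid k.+1 (split_level x y) ->
  exists z, [/\ x != z, y != z, adj x z = a, adj y z = b &
    mid k (split_level x z) && mid k (split_level y z)].
Proof.
move=> kr xy dm.
have side (u v : word_graph N Rs) c : mid k.+1 (split_level u v) -> exists z, [/\ u != z, v != z,
    adj u z = adj u v, adj v z = c & mid k (split_level u z) && mid k (split_level v z)].
  rewrite /mid => dm'; have [e [e1 e2 eo]] := parity_choice (N - 2 * k - 2) c.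
  have [||z [vz lz az]] := @branch v e; [by lia|by lia|].
  have uvz : split_level u v < split_level v z by rewrite lz; lia.
  exists z; rewrite vz az eo (word_adj_ultra uvz) (split_level_ultra uvz) lz.
  by rewrite -split_level_lt (split_level_ultra uvz); split=> //; lia.
case: (eqVneq a b) => [<-|ab].
  rewrite /mid in dm; have [e [e1 e2 eo]] := parity_choice (2 * k) a.
  have [||z [xz lz az]] := @branch x e; [by lia|by lia|].
  rewrite split_levelC in lz.
  have zxy : split_level z x < split_level x y by rewrite lz; lia.
  exists z; rewrite xz az eo (split_levelC x) (split_levelC y) adj_sym.
  rewrite (word_adj_ultra zxy) (split_level_ultra zxy) lz -split_level_lt.
  rewrite split_levelC (split_level_ultra zxy) lz adj_sym az eo /mid.
  by split=> //; lia.
case: (eqVneq (adj x y) a) => h.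
  by have [z [? ? ? ? ?]] := side x y b dm; exists z; rewrite -h.
rewrite split_levelC in dm; have [z [? ? yz ? dz]] := side y x a dm.
exists z; split=> //; last by rewrite andbC.
by rewrite yz adj_sym; move: ab h; case: (adj x y) (a) (b) => [] [] [].
Qed.
End Rel.

Section Forth.
Variables (R R' : nat -> rel 'I_4).
Hypotheses (Rs : forall i, symmetric (R i)) (Rs' : forall i, symmetric (R' i)).
Hypotheses (nR : forall i, i != M -> normal_at R i)
  (nR' : forall i, i != M -> normal_at R' i).
Notation Q := (@word_match R R' Rs Rs').

Lemma word_match_sym k x x' y y' : Q k x x' y y' -> Q k y y' x x'.
Proof.
case=> kr h1 h2 h3; split=> //.
- by rewrite eq_sym h1 eq_sym.
- by rewrite adj_sym h2 adj_sym.
- by rewrite eq_sym split_levelC (split_levelC y').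
Qed.

Lemma word_match_refl k x x' : k <= r -> Q k x x' x x'.
Proof. by move=> kr; split; rewrite ?eqxx ?adj_irr. Qed.

Lemma mid_mono k e : mid k.+1 e -> mid k e.
Proof. rewrite /mid; lia. Qed.

(** A level outside [mid k] lies beyond all of [mid k.+1] on one side, so it compares alike with [d]
    and [d']. *)
Lemma mid_above k d d' e : mid k.+1 d -> mid k.+1 d' -> ~~ mid k e -> d < e -> d' < e.
Proof. rewrite /mid; lia. Qed.

Lemma mid_below k d d' e : mid k.+1 d -> mid k.+1 d' -> ~~ mid k e -> e < d -> e < d'.
Proof. rewrite /mid; lia. Qed.

Lemma word_match_mono k x x' y y' : Q k.+1 x x' y y' -> Q k x x' y y'.
Proof.
case=> kr h1 h2 h3; split=> //; first exact: ltnW.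
by case/h3=> [|/andP[/mid_mono ? /mid_mono ?]]; [left|right; apply/andP].
Qed.

Lemma word_match_intro k (x z : word_graph N Rs) (x' z' : word_graph N Rs') :
  k <= r -> x != z -> x' != z' -> adj x z = adj x' z' ->
  split_level x z = split_level x' z' \/
    mid k (split_level x z) && mid k (split_level x' z') -> Q k x x' z z'.
Proof. by move=> kr /negPf h1 /negPf h2; split; rewrite ?h1 ?h2. Qed.

(** If all levels concerned are in the middle, only adjacencies matter. Otherwise [z] sits alike
    relative to the split of [x], [y] and to that of [x'], [y'], and [z'] branches off at the
    corresponding place. *)
Lemma word_forth k x x' y y' : Q k.+1 x x' y y' ->
  forall z, exists2 z', Q k x x' z z' & Q k y y' z z'.
Proof.
move=> Qxy z; have [kr exy axy lxy] := Qxy; have kr' := ltnW kr.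
case: (eqVneq x z) => [<-|xz].
  by exists x'; [exact: word_match_refl|exact/word_match_sym/word_match_mono].
case: (eqVneq y z) => [<-|yz].
  by exists y'; [exact/word_match_mono|exact: word_match_refl].
have [xy|xy] := eqVneq x y.
  have /eqP xy' : x' == y' by rewrite -exy xy eqxx.
  subst y y'; have [e [eM eN eo _ el]] := level_below nR kr' xz.
  have [z' [xz' lz az]] := branch nR' x' eN eM.
  by exists z'; apply: word_match_intro; rewrite ?az ?lz.
have xy' : x' != y' by rewrite -exy.
have dN := xy; rewrite -split_level_lt in dN.
case: (boolP [&& mid k.+1 (split_level x y), mid k.+1 (split_level x' y'),
    mid k (split_level x z) & mid k (split_level y z)]) => [/and4P[_ d' ez fz]|nm].
  have [z' [xz' yz' ax ay /andP[ez' fz']]] :=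
    deep_extension nR' (adj x z) (adj y z) kr xy' d'.
  by exists z'; apply: word_match_intro => //; right; apply/andP.
(* If the split is not in [mid k.+1], it is the same on both sides and differs from [M]; otherwise
   one of the two new levels lies outside [mid k]. *)
have {lxy} O : (split_level x y = split_level x' y' /\ split_level x y != M) \/
    [/\ mid k.+1 (split_level x y), mid k.+1 (split_level x' y') &
      ~~ (mid k (split_level x z) && mid k (split_level y z))].
  case: (boolP (mid k.+1 (split_level x y))) (lxy xy) nm => /= [dm|ndm] [<-|] //=.
  - by rewrite dm /= => nm; right.
  - by move=> -> /= nm; right.
  - move=> _; left; split=> //; apply: contraNneq ndm => ->; rewrite /mid; lia.
(* Here [z] leaves [u] beneath the split of [u] and [v], so [v] sees [z] as it sees [u]. A reply
   beneath the split of [u'] and [v'] inherits the match of the old pebbles. *)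
have below (u v : word_graph N Rs) (u' v' : word_graph N Rs') :
    Q k.+1 u u' v v' -> u != v -> u != z ->
    split_level u v < split_level u z ->
    split_level u' v' < split_level u z ->
    exists2 z', Q k u u' z z' & Q k v v' z z'.
  move=> Quv uv uz h h'; have [_ euv auv luv] := Quv.
  have [e [eM eN eo ez el]] := level_above nR kr' uz.
  have [z' [uz' lz az]] := branch nR' u' eN eM.
  have h1 : split_level v u < split_level u z by rewrite split_levelC.
  have h2 : split_level v' u' < split_level u' z'.
    by rewrite split_levelC lz; apply: leq_trans h' ez.
  exists z'; first by apply: word_match_intro => //; rewrite ?az ?lz.
  have [_ evu avu lvu] := word_match_mono (word_match_sym Quv).
  rewrite eq_sym in uv.
  have uv' : v' != u' by rewrite -evu.
  apply: word_match_intro => //.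
  - by rewrite -split_level_lt (split_level_ultra h1) split_level_lt.
  - by rewrite -split_level_lt (split_level_ultra h2) split_level_lt.
  - by rewrite (word_adj_ultra h1) (word_adj_ultra h2).
  - by rewrite (split_level_ultra h1) (split_level_ultra h2); apply: lvu.
have ultra (u v w : word_graph N Rs) :
    split_level u v < split_level v w -> split_level u w = split_level u v.
  exact: split_level_ultra.
case: (ltngtP (split_level x z) (split_level x y)) => [lt|gt|eq].
(* [z] leaves before the pebbles split, so both see it at one level and with one adjacency. *)
- have zxy : split_level z x < split_level x y by rewrite split_levelC.
  have yzE : split_level y z = split_level x z.
    by rewrite split_levelC (ultra _ _ _ zxy) split_levelC.
  have d' : split_level x z < split_level x' y'.
    by case: O => [[<- _]//|[dm dm']]; rewrite yzE andbb => nz; apply: mid_below dm dm' nz lt.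
  have [e [eM eN eo ez el]] := level_below nR kr' xz.
  have [z' [xz' lz az]] := branch nR' x' eN eM.
  have zxy' : split_level z' x' < split_level x' y'.
    by rewrite split_levelC lz; apply: leq_ltn_trans d'.
  have yzE' : split_level y' z' = split_level x' z'.
    by rewrite split_levelC (split_level_ultra zxy') split_levelC.
  exists z'; first by apply: word_match_intro => //; rewrite ?az ?lz.
  apply: word_match_intro => //.
  + by rewrite -split_level_lt yzE' lz.
  + rewrite adj_sym (word_adj_ultra zxy) adj_sym -eo -az.
    by rewrite adj_sym -(word_adj_ultra zxy') adj_sym.
  + by rewrite yzE yzE' lz.
- apply: (below x y x' y') => //.
  case: O => [[<- _]//|[dm dm']].
  have yxz : split_level y x < split_level x z by rewrite split_levelC.
  rewrite (ultra _ _ _ yxz) (split_levelC y) (mid_mono dm) andbT => nz.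
  exact: mid_above dm dm' nz gt.
have ge : split_level x y <= split_level y z.
  rewrite leqNgt; apply/negP => h.
  have h1 : split_level z y < split_level y x by rewrite (split_levelC z) (split_levelC y x).
  move: (ultra _ _ _ h1); rewrite split_levelC eq (split_levelC z) => e.
  by rewrite e ltnn in h.
case: (ltngtP (split_level x y) (split_level y z)) ge => // [gt|eq'] _.
  have [z' ? ?] : exists2 z', Q k y y' z z' & Q k x x' z z'.
    have yx : y != x by rewrite eq_sym.
    have dyz : split_level y x < split_level y z by rewrite split_levelC.
    apply: below (word_match_sym Qxy) yx yz dyz _.
    rewrite split_levelC; case: O => [[<- _]//|[dm dm']].
    by rewrite eq (mid_mono dm) => nz; apply: mid_above dm dm' nz gt.
  by exists z'.
case: O => [[d' dM]|[dm dm']]; last by rewrite eq -eq' (mid_mono dm).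
have [|z' [xz' yz' lx ly [ax ay]]] := branch2 nR' xy'; first by rewrite -d'.
have nd : normal_at R (split_level x y) by exact: nR.
have nd' : normal_at R' (split_level x' y') by rewrite -d'; apply: nR'.
exists z'; apply: word_match_intro => //.
- by rewrite ax word_adj_normal eq // word_adj_normal // xz xy' d'.
- by left; rewrite eq lx d'.
- by rewrite ay word_adj_normal -eq' // word_adj_normal // yz xy' d'.
- by left; rewrite -eq' ly d'.
Qed.
End Forth.

Lemma word_match_swap R R' Rs Rs' k x x' y y' :
  @word_match R R' Rs Rs' k x x' y y' -> @word_match R' R Rs' Rs k x' x y' y.
Proof.
case=> kr h1 h2 h3; split=> //; rewrite -h1 => /h3 [->|]; first by left.
by rewrite andbC; right.
Qed.

Lemma word_equiv R R' (Rs : forall i, symmetric (R i)) (Rs' : forall i, symmetric (R' i)) p :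
  (forall i, i != M -> normal_at R i) -> (forall i, i != M -> normal_at R' i) ->
  sentence p -> nvars p <= 3 -> qrank p <= r ->
  (models (word_graph N Rs) p <-> models (word_graph N Rs') p).
Proof.
move=> nR nR' sp np rp; pose o := [tuple ord0 : 'I_4 | i < N].
apply: (@three_pebbles _ _ (@word_match R R' Rs Rs') _ _ _ _ _ _ p o o sp np).
- by move=> k x x' y y' [].
- exact: word_match_sym.
- by move=> k x x' y y' [kr _ _ _]; apply: word_match_refl.
- exact: word_match_mono.
- exact: word_forth.
- move=> k x x' y y' /word_match_swap h z.
  have [z' h1 h2] := word_forth nR' nR h z.
  by exists z'; apply: word_match_swap.
- exact: word_match_refl.
Qed.
End WordGame.

(** * A cograph and its perturbation by one [P4] level *)

Definition alternating (i : nat) : rel 'I_4 := fun _ _ => ~~ odd i.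

Definition P4_at M (i : nat) : rel 'I_4 :=
  if i == M then @adj P4 else alternating i.

Lemma alternating_sym i : symmetric (alternating i).
Proof. by []. Qed.

Lemma P4_at_sym M i : symmetric (P4_at M i).
Proof. by rewrite /P4_at; case: ifP => // _; apply: (@adj_sym P4). Qed.

(** The words that vary only in letter [M] induce the graph placed at that level. *)
Lemma word_P4 N M : M < N -> induced_copy P4 (word_graph N (P4_at_sym M)).
Proof.
move=> MN; pose o := [tuple ord0 : 'I_4 | i < N].
have lev (a b : 'I_4) : a != b -> split_level (set_letter o M a) (set_letter o M b) = M.
  move=> ab; apply: split_level_eq => // [i iM|]; last by rewrite !letter_set // eqxx.
  by rewrite !letter_set ?(ltn_eqF iM) //; apply: ltn_trans MN.
exists (fun a : P4 => set_letter o M a) => [a b /(congr1 (fun w => letter w M))|a b].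
  by rewrite !letter_set // eqxx.
case: (eqVneq a b) => [->|ab]; first by rewrite !adj_irr.
rewrite /= /word_rel -split_level_lt lev // MN /= !letter_set // eqxx.
by rewrite /P4_at eqxx.
Qed.

Lemma P4_width : Wkappa_is P4 4 /\ W_is P4 4.
Proof.
apply: (W_intro (sentence_copy _) (nvars_copy _) (@models_copy _)) => s p sp np.
(* [r] dominates both the rank of [p] and [s]; [M] and [N] are the least values that give
   [word_equiv] its margins on both sides of [M]. *)
pose r := qrank p + s; pose M := 2 * r + 2; pose N := 4 * r + 5.
have nP4 i : i != M -> normal_at (P4_at M) i.
  by move=> /negPf iM a b _; rewrite /P4_at iM.
exists (word_graph N (P4_at_sym M)), (word_graph N alternating_sym); split.
- by apply: word_P4; rewrite /N /M; lia.
- exact: word_P4_free.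
- by apply: word_connected; [apply: nP4; rewrite /M|rewrite /N /r]; lia.
- by apply: word_connected => //; rewrite /N /r; lia.
- by apply: (@word_equiv N M r) => //; rewrite /M /N /r; lia.
Qed.

Theorem theorem5p7 :
  (Wstarkappa_is paw 3 /\ W_is paw 3) /\
  ((Wstarkappa_is P4 3 /\ Wstar_is P4 3) /\
   (Wkappa_is P4 4 /\ W_is P4 4)) /\
  (forall F : graph, F = K4 \/ F = C4 \/ F = claw \/ F = diamond ->
     Wstarkappa_is F 4 /\ W_is F 4).
Proof.
split; first exact: paw_width.
split; first by split; [exact: P4_star_width|exact: P4_width].
by move=> F [->|[->|[->|->]]];
  [exact: K4_width|exact: C4_width|exact: claw_width|exact: diamond_width].
Qed.
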